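(* Let $\mathsf{G}$ be an orbifold groupoid (smooth, étale, proper), Leray, and let $(h,A,B)$ be a gerbe with connection over $\mathsf{G}$. Let $(F,\Delta)$ be its holonomy, a line bundle with connection over the loop groupoid $\mathsf{L}\mathsf{G}$, and let $j:\wedge\mathsf{G}\to\mathsf{L}\mathsf{G}$ be the inclusion of the inertia groupoid as the groupoid of constant loops. Then the restriction $(f,\omega)=j^*(F,\Delta)$ is an inner local system on $\wedge\mathsf{G}$.
   Context: **Groupoids.** A smooth étale groupoid $\mathsf{G}$ is a groupoid whose objects $\mathsf{G}_0$ and arrows $\mathsf{G}_1$ form manifolds and all of whose structure maps (source $\mathsf{s}$, target $\mathsf{t}$, identity $\mathsf{e}$, inverse, composition $\mathsf{m}$) are local diffeomorphisms; it is proper if $(\mathsf{s},\mathsf{t}):\mathsf{G}_1\to\mathsf{G}_0\times\mathsf{G}_0$ is proper. For $g_1:x\to y$, $g_2:y\to z$ the composite is written $g_1g_2$. $\mathsf{G}_k$ is the manifold of composable $k$-strings; $\mathsf{G}$ is Leray if every $\mathsf{G}_k$ is diffeomorphic to a disjoint union of contractible open sets. **Gerbe with connection.** A triple $(h,A,B)$ with $h:\mathsf{G}_2\to\mathbb{C}^\times$ smooth, $A\in\Omega^1(\mathsf{G}_1)\otimes\mathbb{C}$, $B\in\Omega^2(\mathsf{G}_0)\otimes\mathbb{C}$ satisfying $$h(a,b)\,h(a,bc)^{-1}h(ab,c)\,h(b,c)^{-1}=1\ \text{ on }\mathsf{G}_3,\quad \pi_1^*A+\pi_2^*A-\mathsf{m}^*A=d\log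 h\ \text{ on }\mathsf{G}_2,\quad \mathsf{t}^*B-\mathsf{s}^*B=dA\ \text{ on }\mathsf{G}_1,$$ where $\pi_1,\pi_2:\mathsf{G}_2\to\mathsf{G}_1$ are the projections. **Line bundle with connection on a groupoid $\mathsf{K}$.** A pair $(f,\omega)$ of a smooth function $f:\mathsf{K}_1\to\mathbb{C}^\times$ with $f(g_1g_2)=f(g_1)f(g_2)$ and a complex 1-form $\omega$ on $\mathsf{K}_0$ with $\mathsf{t}^*\omega-\mathsf{s}^*\omega=-d\log f$. It is flat if $d\omega=0$. **Inertia groupoid.** $\wedge\mathsf{G}$ has objects $(\wedge\mathsf{G})_0=\{v\in\mathsf{G}_1:\mathsf{s}(v)=\mathsf{t}(v)\}$ and arrows the pairs $(v,\alpha)$ with $v\in(\wedge\mathsf{G})_0$, $\alpha\in\mathsf{G}_1$, $\mathsf{s}(\alpha)=\mathsf{t}(v)$; the arrow $(v,\alpha)$ goes from $v$ to $\alpha^{-1}v\alpha$. Its inverse map on arrows is $i(v,\alpha)=(\alpha^{-1}v\alpha,\alpha^{-1})$. **Loops and holonomy.** It suffices here to use loops subordinate to the partition $\{0,1\}$ of $[0,1]$: objects are pairs $\psi=(\psi_1:[0,1]\to\mathsf{G}_0,\ \psi(1)\in\mathsf{G}_1)$ with $\psi_1$ smooth, $\mathsf{s}(\psi(1))=\psi_1(1)$, $\mathsf{t}(\psi(1))=\psi_1(0)$ (and $\psi_1$ fitting smoothly at the endpoints via the local diffeomorphism given by $\psi(1)$); arrows $\Lambda:\psi\to\phi$ are smooth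 maps $\Lambda_1:[0,1]\to\mathsf{G}_1$ with $\mathsf{s}\Lambda_1=\psi_1$, $\mathsf{t}\Lambda_1=\phi_1$, $\Lambda_1(1)\phi(1)=\psi(1)\Lambda_1(0)$. The holonomy of $(h,A,B)$ is $(F,\Delta)$ with $$F(\Lambda)=\exp\Big(\int_0^1\Lambda_1^*A\Big)\frac{h(\psi(1),\Lambda_1(0))}{h(\Lambda_1(1),\phi(1))},\qquad \langle\Delta_\psi,\xi\rangle=\int_0^1B\Big(\frac{d\psi_1}{dt},\xi_1(t)\Big)dt+\langle A_{\psi(1)},\xi(1)\rangle,$$ where a tangent vector $\xi$ at $\psi$ is a vector field $\xi_1$ along $\psi_1$ together with $\xi(1)\in T_{\psi(1)}\mathsf{G}_1$ projecting under $d\mathsf{s}$, $d\mathsf{t}$ to $\xi_1(1)$, $\xi_1(0)$. The inclusion $j$ sends $v$ to the constant loop $\psi_1\equiv\mathsf{s}(v)$, $\psi(1)=v$, and $(v,\alpha)$ to the constant arrow $\Lambda_1\equiv\alpha$. Thus $$f(v,\alpha)=\frac{h(v,\alpha)}{h(\alpha,\alpha^{-1}v\alpha)},\qquad \omega=A|_{(\wedge\mathsf{G})_0}.$$ **Inner local system.** A flat line bundle $\mathcal{L}=(f,\omega)$ over $\wedge\mathsf{G}$ such that: - $\mathcal{L}$ is trivial when restricted to $\mathsf{e}(\mathsf{G}_0)\subset(\wedge\mathsf{G})_0$, i.e. there is a smooth $u:\mathsf{G}_0\to\mathbb{C}^\times$ with $f(\mathsf{e}(x),\alpha)=u(y)u(x)^{-1}$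 for every arrow $\alpha:x\to y$ of $\mathsf{G}$; - $i^*\mathcal{L}=\mathcal{L}^{-1}$, i.e. $f(i(v,\alpha))=f(v,\alpha)^{-1}$ for all $(v,\alpha)$. *)

(* Defs.v *)
From HB Require Import structures.
From mathcomp Require Import all_boot all_order all_algebra.
From mathcomp Require Import all_classical all_reals all_analysis.
From mathcomp Require Import complex.

Set Implicit Arguments.
Unset Strict Implicit.
Unset Printing Implicit Defensive.

Import Order.TTheory GRing.Theory Num.Theory.
Import numFieldNormedType.Exports.
Local Open Scope classical_set_scope.
Local Open Scope ring_scope.
Local Open Scope complex_scope.

Section Calculus.
Variable R : realType.

(* Meant for an open set U of a finite dimensional V: there, f is C^k on U iff
   its iterated directional derivatives of order < k are differentiable and
   those of order k are continuous on U. *)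
Fixpoint Ck (V W : normedModType R) (k : nat) (U : set V) (f : V -> W) : Prop :=
  match k with
  | 0 => forall x, U x -> {for x, continuous f}
  | k'.+1 => (forall x, U x -> differentiable f x) /\
             (forall v : V, Ck k' U ('D_v f))
  end.

Definition Cinf (V W : normedModType R) (U : set V) (f : V -> W) : Prop :=
  forall k, Ck k U f.

Definition cCinf (V : normedModType R) (U : set V) (f : V -> R[i]) : Prop :=
  Cinf (W := R^o) U (fun x => complex.Re (f x)) /\
  Cinf (W := R^o) U (fun x => complex.Im (f x)).

Definition cderive (V : normedModType R) (v : V) (f : V -> R[i]) (x : V) : R[i] :=
  'D_v (fun y => complex.Re (f y) : R^o) x +i* 'D_v (fun y => complex.Im (f y) : R^o) x.

Definition cexp (z : R[i]) : R[i] :=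
  (expR (complex.Re z) * cos (complex.Im z)) +i*
  (expR (complex.Re z) * sin (complex.Im z)).

Definition cint01 (f : R -> R[i]) : R[i] :=
  (\int[@lebesgue_measure R]_(t in `[0, 1]) complex.Re (f t))%R +i*
  (\int[@lebesgue_measure R]_(t in `[0, 1]) complex.Im (f t))%R.

End Calculus.

Section Manifolds.
Variable R : realType.

(* [cmap] and [cinv] are only meaningful on [cdom] and [crng]. The dimension
   belongs to the chart: the components of a manifold may have different
   dimensions, as those of the objects of an inertia groupoid do. *)
Record chart (M : Type) := Chart {
  cdim : nat;
  cdom : set M;
  crng : set 'rV[R]_cdim;
  cmap : M -> 'rV[R]_cdim;
  cinv : 'rV[R]_cdim -> M }.

Record smooth_space := SmoothSpace {
  points :> topologicalType;
  atlas : set (chart points) }.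

Definition is_chart (M : topologicalType) (c : chart M) : Prop :=
  [/\ open (cdom c), open (@crng _ c),
      (forall x, cdom c x -> crng (cmap c x) /\ cinv (cmap c x) = x),
      (forall p, @crng _ c p -> cdom c (cinv p) /\ cmap c (cinv p) = p) &
      (forall x, cdom c x -> {for x, continuous (cmap c)}) /\
      (forall p, @crng _ c p -> {for p, continuous (@cinv _ c)})].

Definition smooth_transition (M : Type) (c d : chart M) : Prop :=
  Cinf [set p | @crng _ c p /\ cdom d (cinv p)] (fun p => cmap d (@cinv _ c p)).

Definition compatible (M : Type) (c d : chart M) : Prop :=
  smooth_transition c d /\ smooth_transition d c.

Definition is_manifold (M : smooth_space) : Prop :=
  [/\ hausdorff_space M, @second_countable M,
      (forall x : M, exists2 c, atlas c & cdom c x),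
      (forall c, @atlas M c -> is_chart c /\ forall d, @atlas M d -> compatible c d) &
      (forall c : chart M,
         is_chart c -> (forall d, atlas d -> compatible c d) -> atlas c)].

Definition smooth_on (M N : smooth_space) (U : set M) (f : M -> N) : Prop :=
  forall x, U x -> forall c, atlas c -> cdom c x ->
  exists d, [/\ atlas d, cdom d (f x) &
    exists V : set 'rV[R]_(cdim c), [/\ open V, V (cmap c x), V `<=` @crng _ c,
      (forall p, V p -> cdom d (f (cinv p))) &
      Cinf V (fun p => cmap d (f (cinv p)))]].

Definition smooth (M N : smooth_space) (f : M -> N) : Prop := smooth_on setT f.

Definition csmooth (M : smooth_space) (f : M -> R[i]) : Prop :=
  forall c, @atlas M c -> cCinf (@crng _ c) (fun p => f (cinv p)).

Definition local_diffeo (M N : smooth_space) (f : M -> N) : Prop :=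
  forall x : M, exists (U : set M) (V : set N) (g : N -> M),
  [/\ open U, U x, open V,
      (forall y, U y -> V (f y) /\ g (f y) = y) /\
      (forall z, V z -> U (g z) /\ f (g z) = z) &
      smooth_on U f /\ smooth_on V g].

Definition prod_chart (M N : Type) (c : chart M) (d : chart N) : chart (M * N) :=
  @Chart (M * N)%type (cdim c + cdim d) (cdom c `*` cdom d)
    [set p | @crng _ c (lsubmx p) /\ @crng _ d (rsubmx p)]
    (fun x => row_mx (cmap c x.1) (cmap d x.2))
    (fun p => (@cinv _ c (lsubmx p), @cinv _ d (rsubmx p))).

(* The maximal atlas compatible with products of charts. *)
Definition prod_space (M N : smooth_space) : smooth_space :=
  @SmoothSpace (M * N)%type
    [set C : chart (M * N)%type | is_chart C /\
      forall c d, @atlas M c -> @atlas N d -> compatible C (prod_chart c d)].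

Definition pad (k n : nat) (q : 'rV[R]_k) : 'rV[R]_n :=
  \row_(i < n) (if insub (i : nat) is Some j then q 0 (j : 'I_k) else 0).

(* [d] is the chart induced on S by a slice chart [c] of M: the points of S in
   the domain of [c] are those whose coordinates of index >= cdim d vanish. *)
Definition slice_of (M : smooth_space) (S : set M) (c : chart M) (d : chart S)
    : Prop :=
  [/\ (cdim d <= cdim c)%N,
      (forall x, cdom c x ->
         S x <-> forall i : 'I_(cdim c), (cdim d <= i)%N -> cmap c x 0 i = 0),
      (forall x : S, cdom d x <-> cdom c (set_val x)),
      (forall q, @crng _ d q <-> @crng _ c (pad _ q)) &
      (forall x : S, cdom d x -> cmap d x = pad _ (cmap c (set_val x))) /\
      (forall q, @crng _ d q -> set_val (@cinv _ d q) = @cinv _ c (pad _ q))].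

(* The embedded submanifold structure of S: the subspace topology, with the
   (not necessarily maximal) atlas of slice charts. It is used below for loci
   that do have a slice chart at each of their points: spaces of composable
   strings of an etale groupoid, and the objects and arrows of the inertia
   groupoid of an orbifold groupoid, which are locally fixed loci of diffeo-
   morphisms of finite order. *)
Definition sub_space (M : smooth_space) (S : set M) : smooth_space :=
  @SmoothSpace (set_type S)
    [set d : chart S | exists2 c : chart M, atlas c & slice_of c d].

(* Tangent vectors at x are represented by curves through x at time 0 that are
   smooth near 0, up to equality of velocities. Hence the differential of a
   smooth map f sends the class of g to that of f \o g. *)
Definition smooth_curve_at (M : smooth_space) (g : R -> M) (t : R) : Prop :=
  exists c, [/\ @atlas M c, cdom c (g t) &
    exists V : set R^o, [/\ open V, V t, (forall s, V s -> cdom c (g s)) &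
      Cinf V (fun s : R^o => cmap c (g s))]].

Definition smooth_curve (M : smooth_space) (g : R -> M) := smooth_curve_at g 0.

Definition velocity (M : smooth_space) (c : chart M) (g : R -> M) : 'rV[R]_(cdim c) :=
  'D_(1 : R^o) (fun s : R^o => cmap c (g s)) 0.

Definition same_velocity (M : smooth_space) (g g' : R -> M) : Prop :=
  g 0 = g' 0 /\
  forall c, @atlas M c -> cdom c (g 0) -> velocity c g = velocity c g'.

(* A complex differential form is given by its values on (pairs of) tangent
   vectors, i.e. on curves; its values on curves that are not smooth, or on
   pairs of curves with different base points, are irrelevant. *)
Definition form1 (M : smooth_space) := (R -> M) -> R[i].
Definition form2 (M : smooth_space) := (R -> M) -> (R -> M) -> R[i].

Definition is_form1 (M : smooth_space) (A : form1 M) : Prop :=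
  forall c, @atlas M c -> exists a : 'I_(cdim c) -> 'rV[R]_(cdim c) -> R[i],
  (forall i, cCinf (@crng _ c) (a i)) /\
  forall g, smooth_curve g -> cdom c (g 0) ->
    A g = \sum_i a i (cmap c (g 0)) * (velocity c g 0 i)%:C.

Definition is_form2 (M : smooth_space) (B : form2 M) : Prop :=
  forall c, @atlas M c ->
  exists b : 'I_(cdim c) -> 'I_(cdim c) -> 'rV[R]_(cdim c) -> R[i],
  [/\ (forall i j, cCinf (@crng _ c) (b i j)),
      (forall i j p, b i j p = - b j i p) &
      forall g g', smooth_curve g -> smooth_curve g' -> g 0 = g' 0 ->
        cdom c (g 0) ->
        B g g' = \sum_i \sum_j b i j (cmap c (g 0)) *
                   (velocity c g 0 i)%:C * (velocity c g' 0 j)%:C].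

Definition pull1 (M N : smooth_space) (f : M -> N) (A : form1 N) : form1 M :=
  fun g => A (f \o g).

Definition pull2 (M N : smooth_space) (f : M -> N) (B : form2 N) : form2 M :=
  fun g g' => B (f \o g) (f \o g').

(* The curve representing the i-th coordinate vector field at [cinv p]. *)
Definition coord_curve (M : Type) (c : chart M) (p : 'rV[R]_(cdim c))
    (i : 'I_(cdim c)) : R -> M :=
  fun t => cinv (p + t *: delta_mx 0 i).

(* B = dA, checked on coordinate vector fields. *)
Definition is_d (M : smooth_space) (A : form1 M) (B : form2 M) : Prop :=
  forall c, @atlas M c -> forall p, @crng _ c p -> forall i j : 'I_(cdim c),
    B (coord_curve p i) (coord_curve p j) =
    cderive (delta_mx 0 i) (fun q => A (coord_curve q j)) p -
    cderive (delta_mx 0 j) (fun q => A (coord_curve q i)) p.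

Definition dlog (M : smooth_space) (f : M -> R[i]) : form1 M :=
  fun g => cderive (1 : R^o) (fun t : R^o => f (g t)) 0 / f (g 0).

Definition eq_form1 (M : smooth_space) (A A' : form1 M) : Prop :=
  forall g, smooth_curve g -> A g = A' g.

Definition contractible (X : topologicalType) (U : set X) : Prop :=
  exists (x0 : X) (H : R * X -> X),
  [/\ U x0, {within `[0, 1] `*` U, continuous H},
      (forall t x, `[0, 1]%classic t -> U x -> U (H (t, x))) &
      (forall x, U x -> H (0, x) = x /\ H (1, x) = x0)].

End Manifolds.

Section Groupoids.
Variable R : realType.

(* [mul a b] is the composite ab of a : x -> y followed by b : y -> z; its
   value is irrelevant when [tgt a <> src b]. *)
Record groupoid := Groupoid {
  obj : smooth_space R;
  arr : smooth_space R;
  src : arr -> obj;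
  tgt : arr -> obj;
  idn : obj -> arr;
  inv : arr -> arr;
  mul : arr -> arr -> arr;
  src_mul : forall a b, tgt a = src b -> src (mul a b) = src a;
  tgt_mul : forall a b, tgt a = src b -> tgt (mul a b) = tgt b;
  mulA : forall a b c, tgt a = src b -> tgt b = src c ->
    mul a (mul b c) = mul (mul a b) c;
  src_idn : forall x, src (idn x) = x;
  tgt_idn : forall x, tgt (idn x) = x;
  mul_idnl : forall a, mul (idn (src a)) a = a;
  mul_idnr : forall a, mul a (idn (tgt a)) = a;
  src_inv : forall a, src (inv a) = tgt a;
  tgt_inv : forall a, tgt (inv a) = src a;
  mul_invl : forall a, mul (inv a) a = idn (tgt a);
  mul_invr : forall a, mul a (inv a) = idn (src a) }.

Variable G : groupoid.

Definition composable : smooth_space R :=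
  @sub_space R (prod_space (arr G) (arr G)) [set p | tgt p.1 = src p.2].

Definition comp_fst (p : composable) : arr G := (set_val p).1.
Definition comp_snd (p : composable) : arr G := (set_val p).2.
Definition comp_mul (p : composable) : arr G := mul (comp_fst p) (comp_snd p).

Definition etale : Prop :=
  [/\ is_manifold (obj G), is_manifold (arr G),
      local_diffeo (@src G) /\ local_diffeo (@tgt G),
      local_diffeo (@idn G) /\ local_diffeo (@inv G) &
      local_diffeo comp_mul].

Definition proper : Prop :=
  forall K : set (obj G * obj G), compact K ->
    compact ((fun a => (src a, tgt a)) @^-1` K).

Definition orbifold_groupoid : Prop := etale /\ proper.

(* Composable strings of k+1 arrows, with their final target. *)
Fixpoint strings (k : nat) : {X : smooth_space R & X -> obj G} :=
  match k with
  | 0 => existT (fun X : smooth_space R => X -> obj G) (arr G) (@tgt G)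
  | k'.+1 =>
    let X := projT1 (strings k') in
    let e := projT2 (strings k') in
    existT (fun X : smooth_space R => X -> obj G)
      (@sub_space R (prod_space X (arr G)) [set p | e p.1 = src p.2])
      (fun p => tgt (set_val p).2)
  end.

Definition nerve (k : nat) : smooth_space R :=
  match k with 0 => obj G | k'.+1 => projT1 (strings k') end.

(* P is the set of summands of a decomposition of the k-th space as a disjoint
   union of contractible open sets. *)
Definition Leray : Prop :=
  forall k, exists P : set (set (nerve k)),
  [/\ (forall U, P U -> open U /\ contractible R U),
      (forall U V, P U -> P V -> U `&` V !=set0 -> U = V) &
      forall x, exists2 U, P U & U x].

Definition is_gerbe (h : arr G -> arr G -> R[i]) (A : form1 (arr G))
    (B : form2 (obj G)) : Prop :=
  [/\ (forall a b, tgt a = src b -> h a b != 0) /\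
      csmooth (fun p : composable => h (comp_fst p) (comp_snd p)),
      is_form1 A /\ is_form2 B,
      (forall a b c, tgt a = src b -> tgt b = src c ->
         h a b * (h a (mul b c))^-1 * h (mul a b) c * (h b c)^-1 = 1),
      eq_form1 (fun g => pull1 comp_fst A g + pull1 comp_snd A g
                         - pull1 comp_mul A g)
               (dlog (fun p : composable => h (comp_fst p) (comp_snd p))) &
      is_d A (fun g g' => pull2 (@tgt G) B g g' - pull2 (@src G) B g g')].

Definition is_line_bundle (f : arr G -> R[i]) (omega : form1 (obj G)) : Prop :=
  [/\ (forall a, f a != 0), csmooth f,
      (forall a b, tgt a = src b -> f (mul a b) = f a * f b),
      is_form1 omega &
      eq_form1 (fun g => pull1 (@tgt G) omega g - pull1 (@src G) omega g)
               (fun g => - dlog f g)].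

Definition flat (omega : form1 (obj G)) : Prop := is_d omega (fun _ _ => 0).

End Groupoids.

Section Inertia.
Variables (R : realType) (G : groupoid R).

Definition inertia_obj : smooth_space R :=
  @sub_space R (arr G) [set v | src v = tgt v].

Definition inertia_arr : smooth_space R :=
  @sub_space R (prod_space (arr G) (arr G))
    [set p | src p.1 = tgt p.1 /\ src p.2 = tgt p.1].

Definition mk_iobj (v : arr G) (hv : src v = tgt v) : inertia_obj :=
  exist _ v (mem_set hv).

Definition mk_iarr (v a : arr G) (hv : src v = tgt v) (ha : src a = tgt v)
  : inertia_arr :=
  exist _ (v, a) (mem_set (conj hv ha : [set p : arr G * arr G |
    src p.1 = tgt p.1 /\ src p.2 = tgt p.1] (v, a))).

Definition loop_of (x : inertia_obj) : arr G := set_val x.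
Definition iarr_loop (k : inertia_arr) : arr G := (set_val k).1.
Definition iarr_arrow (k : inertia_arr) : arr G := (set_val k).2.

Lemma loop_ofP (x : inertia_obj) : src (loop_of x) = tgt (loop_of x).
Proof. exact: (set_mem (valP x)). Qed.

Lemma iarr_loopP (k : inertia_arr) : src (iarr_loop k) = tgt (iarr_loop k).
Proof. by case: (set_mem (valP k)). Qed.

Lemma iarr_arrowP (k : inertia_arr) : src (iarr_arrow k) = tgt (iarr_loop k).
Proof. by case: (set_mem (valP k)). Qed.

Lemma iobj_eq (x y : inertia_obj) : loop_of x = loop_of y -> x = y.
Proof. exact: val_inj. Qed.

Lemma iarr_eq (k l : inertia_arr) :
  iarr_loop k = iarr_loop l -> iarr_arrow k = iarr_arrow l -> k = l.
Proof.
move=> e1 e2; apply: val_inj; rewrite [LHS]surjective_pairing.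
by rewrite [RHS]surjective_pairing; congr pair.
Qed.

Definition conjug (v a : arr G) : arr G := mul (inv a) (mul v a).

Lemma src_conjug v a : src v = tgt v -> src a = tgt v -> src (conjug v a) = tgt a.
Proof.
by move=> hv ha; rewrite /conjug src_mul ?src_inv// tgt_inv src_mul// hv ha.
Qed.

Lemma tgt_conjug v a : src v = tgt v -> src a = tgt v -> tgt (conjug v a) = tgt a.
Proof.
by move=> hv ha; rewrite /conjug !tgt_mul// tgt_inv src_mul// hv ha.
Qed.

Lemma conjug_idn v : src v = tgt v -> conjug v (idn (tgt v)) = v.
Proof.
move=> hv; rewrite /conjug mul_idnr.
have -> : inv (idn (tgt v)) = idn (tgt v).
  have := mul_idnr (inv (idn (tgt v))).
  by rewrite tgt_inv src_idn => <-; rewrite mul_invl tgt_idn.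
by rewrite -hv mul_idnl.
Qed.

Lemma mul_invK (a b : arr G) : tgt a = src b -> mul (inv a) (mul a b) = b.
Proof.
move=> ab; rewrite mulA ?tgt_inv// mul_invl ab.
exact: mul_idnl.
Qed.

Lemma inv_mul (a b : arr G) :
  tgt a = src b -> inv (mul a b) = mul (inv b) (inv a).
Proof.
move=> ab; have h : tgt (inv b) = src (inv a) by rewrite tgt_inv src_inv.
have h1 : tgt (mul a b) = src (mul (inv b) (inv a)).
  by rewrite tgt_mul// src_mul// src_inv.
rewrite -[RHS](mul_invK h1) -mulA//; last by rewrite src_mul// src_inv.
rewrite (@mulA _ _ b)// ?src_inv// mul_invr -ab.
have -> : mul (idn (tgt a)) (inv a) = inv a.
  by rewrite -(src_inv a) mul_idnl.
rewrite mul_invr; have := mul_idnr (inv (mul a b)).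
by rewrite tgt_inv src_mul.
Qed.

Lemma conjug_mul v a b : src v = tgt v -> src a = tgt v -> tgt a = src b ->
  conjug (conjug v a) b = conjug v (mul a b).
Proof.
move=> hv ha ab; rewrite /conjug inv_mul//.
have va : tgt (inv a) = src (mul v a) by rewrite tgt_inv src_mul// hv.
have vab : tgt (mul v a) = src b by rewrite tgt_mul.
have e1 : mul v (mul a b) = mul (mul v a) b by rewrite mulA.
rewrite e1 -(@mulA _ _ (inv a))// -[RHS]mulA//.
- by rewrite tgt_inv src_inv.
- by rewrite src_mul.
Qed.

Definition isrc (k : inertia_arr) : inertia_obj := mk_iobj (iarr_loopP k).

Lemma itgt_subproof (k : inertia_arr) :
  src (conjug (iarr_loop k) (iarr_arrow k)) = tgt (conjug (iarr_loop k) (iarr_arrow k)).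
Proof.
by rewrite src_conjug ?tgt_conjug//; [exact: iarr_loopP|exact: iarr_arrowP
  |exact: iarr_loopP|exact: iarr_arrowP].
Qed.

Definition itgt (k : inertia_arr) : inertia_obj := mk_iobj (itgt_subproof k).

Definition iidn (x : inertia_obj) : inertia_arr :=
  mk_iarr (loop_ofP x) (src_idn (tgt (loop_of x))).

Lemma iinv_subproof (k : inertia_arr) :
  src (inv (iarr_arrow k)) = tgt (conjug (iarr_loop k) (iarr_arrow k)).
Proof.
by rewrite src_inv tgt_conjug//; [exact: iarr_loopP|exact: iarr_arrowP].
Qed.

Definition iinv (k : inertia_arr) : inertia_arr :=
  mk_iarr (itgt_subproof k) (iinv_subproof k).

Lemma itgt_isrc (k l : inertia_arr) :
  itgt k = isrc l -> tgt (iarr_arrow k) = src (iarr_arrow l).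
Proof.
move=> /(congr1 loop_of) /= kl; rewrite iarr_arrowP.
rewrite -(_ : tgt (loop_of (itgt k)) = tgt (iarr_arrow k)).
  by rewrite [loop_of _]kl.
by rewrite tgt_conjug//; [exact: iarr_loopP|exact: iarr_arrowP].
Qed.

Lemma imul_subproof (k l : inertia_arr) : itgt k = isrc l ->
  src (mul (iarr_arrow k) (iarr_arrow l)) = tgt (iarr_loop k).
Proof. by move=> kl; rewrite src_mul; [exact: iarr_arrowP|exact: itgt_isrc]. Qed.

Definition imul (k l : inertia_arr) : inertia_arr :=
  if pselect (itgt k = isrc l) is left kl
  then mk_iarr (iarr_loopP k) (imul_subproof kl) else k.

Lemma imulE (k l : inertia_arr) (kl : itgt k = isrc l) :
  imul k l = mk_iarr (iarr_loopP k) (imul_subproof kl).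
Proof.
rewrite /imul; case: pselect => // e; exact: iarr_eq.
Qed.

Fact isrc_mul k l : itgt k = isrc l -> isrc (imul k l) = isrc k.
Proof. by move=> kl; rewrite imulE; exact: iobj_eq. Qed.

Fact itgt_mul k l : itgt k = isrc l -> itgt (imul k l) = itgt l.
Proof.
move=> kl; rewrite imulE; apply: iobj_eq.
have e : conjug (iarr_loop k) (iarr_arrow k) = iarr_loop l.
  exact: (congr1 loop_of kl).
rewrite -[RHS]/(conjug (iarr_loop l) (iarr_arrow l)) -e conjug_mul//.
- exact: iarr_loopP.
- exact: iarr_arrowP.
- exact: itgt_isrc.
Qed.

Fact imulA k l m : itgt k = isrc l -> itgt l = isrc m ->
  imul k (imul l m) = imul (imul k l) m.
Proof.
move=> kl lm.
have h1 : itgt k = isrc (imul l m) by rewrite isrc_mul.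
have h2 : itgt (imul k l) = isrc m by rewrite itgt_mul.
rewrite (imulE h1) (imulE h2); apply: iarr_eq.
  by rewrite /iarr_loop /= (imulE kl).
rewrite /iarr_arrow /= (imulE kl) (imulE lm) /iarr_arrow /=.
by apply: mulA; exact: itgt_isrc.
Qed.

Fact isrc_idn x : isrc (iidn x) = x.
Proof. exact: iobj_eq. Qed.

Fact itgt_idn x : itgt (iidn x) = x.
Proof. apply: iobj_eq; rewrite /loop_of /=; apply: conjug_idn; exact: loop_ofP. Qed.

Fact imul_idnl k : imul (iidn (isrc k)) k = k.
Proof.
have h : itgt (iidn (isrc k)) = isrc k by rewrite itgt_idn.
rewrite (imulE h); apply: iarr_eq => //.
rewrite -[LHS]/(mul (idn (tgt (iarr_loop k))) (iarr_arrow k)) -iarr_arrowP.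
exact: mul_idnl.
Qed.

Fact imul_idnr k : imul k (iidn (itgt k)) = k.
Proof.
have h : itgt k = isrc (iidn (itgt k)) by rewrite isrc_idn.
rewrite (imulE h); apply: iarr_eq => //.
rewrite -[LHS]/(mul (iarr_arrow k)
  (idn (tgt (conjug (iarr_loop k) (iarr_arrow k))))) tgt_conjug.
- exact: mul_idnr.
- exact: iarr_loopP.
- exact: iarr_arrowP.
Qed.

Fact isrc_inv k : isrc (iinv k) = itgt k.
Proof. exact: iobj_eq. Qed.

Fact itgt_inv k : itgt (iinv k) = isrc k.
Proof.
apply: iobj_eq; have vP := iarr_loopP k; have aP := iarr_arrowP k.
rewrite -[LHS]/(conjug (conjug (iarr_loop k) (iarr_arrow k))
  (inv (iarr_arrow k))) conjug_mul ?src_inv// mul_invr aP.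
exact: conjug_idn.
Qed.

Fact imul_invl k : imul (iinv k) k = iidn (itgt k).
Proof.
rewrite (imulE (itgt_inv k)); apply: iarr_eq => //.
rewrite -[RHS]/(idn (tgt (conjug (iarr_loop k) (iarr_arrow k)))) tgt_conjug.
- exact: mul_invl.
- exact: iarr_loopP.
- exact: iarr_arrowP.
Qed.

Fact imul_invr k : imul k (iinv k) = iidn (isrc k).
Proof.
rewrite (imulE (esym (isrc_inv k))); apply: iarr_eq => //.
rewrite -[RHS]/(idn (tgt (iarr_loop k))) -iarr_arrowP; exact: mul_invr.
Qed.

Definition inertia : groupoid R :=
  Groupoid isrc_mul itgt_mul imulA isrc_idn itgt_idn imul_idnl imul_idnr
           isrc_inv itgt_inv imul_invl imul_invr.

(* The arrow (e(x), a) of the inertia groupoid, for a : x -> y. *)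
Definition unit_iarr (a : arr G) : arr inertia :=
  @mk_iarr (idn (src a)) a
    (etrans (src_idn (src a)) (esym (tgt_idn (src a))))
    (esym (tgt_idn (src a))).

Definition inner_local_system (f : arr inertia -> R[i])
    (omega : form1 (obj inertia)) : Prop :=
  [/\ is_line_bundle f omega,
      flat omega,
      (exists u : obj G -> R[i], [/\ (forall x, u x != 0), csmooth u &
         forall a : arr G, f (unit_iarr a) = u (tgt a) * (u (src a))^-1]) &
      forall k : arr inertia, f (inv k) = (f k)^-1].

End Inertia.

Section Loops.
Variables (R : realType) (G : groupoid R).

Definition smooth_path (M : smooth_space R) (g : R -> M) : Prop :=
  forall t : R, 0 <= t <= 1 -> smooth_curve_at g t.

(* A smooth map on [0, 1] is represented by a map on R that is smooth on a
   neighbourhood of [0, 1]; only its restriction to [0, 1] matters.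
   [loop_fit] says that psi_1 near 1, transported by the local diffeomorphism
   tgt o src^-1 given by psi(1), continues smoothly as psi_1 near 0. *)
Record loop := Loop {
  loop_path : R -> obj G;
  loop_end : arr G;
  loop_smooth : smooth_path loop_path;
  loop_src : src loop_end = loop_path 1;
  loop_tgt : tgt loop_end = loop_path 0;
  loop_fit : exists eta : R -> arr G,
    [/\ smooth_curve eta, eta 0 = loop_end &
        \forall e \near (0 : R),
          (e <= 0 -> src (eta e) = loop_path (1 + e)) /\
          (0 <= e -> tgt (eta e) = loop_path e)] }.

Record loop_arrow (psi phi : loop) := LoopArrow {
  la_path : R -> arr G;
  la_smooth : smooth_path la_path;
  la_src : forall t : R, 0 <= t <= 1 -> src (la_path t) = loop_path psi t;
  la_tgt : forall t : R, 0 <= t <= 1 -> tgt (la_path t) = loop_path phi t;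
  la_end : mul (la_path 1) (loop_end phi) = mul (loop_end psi) (la_path 0) }.

Definition smooth_field (M : smooth_space R) (xi : R -> R -> M) : Prop :=
  forall t : R, 0 <= t <= 1 -> smooth_curve (xi t) /\
  exists c, [/\ @atlas _ M c, cdom c (xi t 0) &
    exists V : set R^o, [/\ open V, V t, (forall s, V s -> cdom c (xi s 0)) &
      Cinf V (fun s : R^o => velocity c (xi s))]].

(* A tangent vector at psi; [lv_path t] represents xi_1(t), and [lv_end]
   represents xi(1). *)
Record loop_vector (psi : loop) := LoopVector {
  lv_path : R -> R -> obj G;
  lv_end : R -> arr G;
  lv_smooth : smooth_field lv_path;
  lv_base : forall t : R, 0 <= t <= 1 -> lv_path t 0 = loop_path psi t;
  lv_end_smooth : smooth_curve lv_end;
  lv_end_base : lv_end 0 = loop_end psi;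
  lv_src : same_velocity (@src R G \o lv_end) (lv_path 1);
  lv_tgt : same_velocity (@tgt R G \o lv_end) (lv_path 0) }.

Variables (h : arr G -> arr G -> R[i]) (A : form1 (arr G)) (B : form2 (obj G)).

Definition tangent_curve (M : smooth_space R) (g : R -> M) (t : R) : R -> M :=
  fun s => g (t + s).

Definition holonomy (psi phi : loop) (L : loop_arrow psi phi) : R[i] :=
  cexp (cint01 (fun t => A (tangent_curve (la_path L) t))) *
  (h (loop_end psi) (la_path L 0) / h (la_path L 1) (loop_end phi)).

Definition holonomy_connection (psi : loop) (xi : loop_vector psi) : R[i] :=
  cint01 (fun t => B (tangent_curve (loop_path psi) t) (lv_path xi t)) +
  A (lv_end xi).

Hypothesis hG : orbifold_groupoid G.

Lemma Cinf_cst (V W : normedModType R) (U : set V) (a : W) :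
  Cinf U (fun _ => a).
Proof.
move=> k; elim: k a => [|k IHk] a; first by move=> x _; exact: cst_continuous.
split=> [x _|v]; first exact: differentiable_cst.
have -> : 'D_v (fun _ : V => a) = (fun _ => 0 : W).
  by apply/funext => x; exact: derive_cst.
exact: IHk.
Qed.

Lemma smooth_cst (M : smooth_space R) (x : M) (t : R) :
  is_manifold M -> smooth_curve_at (fun _ => x) t.
Proof.
case=> _ _ cov _ _; have [c ac cx] := cov x.
exists c; split=> //; exists setT; split=> //; first exact: openT.
exact: Cinf_cst.
Qed.

Fact const_loop_smooth (x : obj G) : smooth_path (fun _ => x).
Proof. by move=> t _; apply: smooth_cst; case: hG => -[]. Qed.

Fact const_arrow_smooth (a : arr G) (t : R) : smooth_curve_at (fun _ => a) t.
Proof. by apply: smooth_cst; case: hG => -[]. Qed.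

Fact const_loop_fit (v : obj (inertia G)) : exists eta : R -> arr G,
  [/\ smooth_curve eta, eta 0 = loop_of v &
      \forall e \near (0 : R),
        (e <= 0 -> src (eta e) = src (loop_of v)) /\
        (0 <= e -> tgt (eta e) = src (loop_of v))].
Proof.
exists (fun _ => loop_of v); split=> //; first exact: const_arrow_smooth.
by near=> e; rewrite loop_ofP.
Unshelve. all: by end_near.
Qed.

Definition const_loop (v : obj (inertia G)) : loop :=
  @Loop (fun _ => src (loop_of v)) (loop_of v) (@const_loop_smooth _)
    erefl (esym (loop_ofP v)) (const_loop_fit v).

Fact const_arrow_src (k : arr (inertia G)) :
  src (iarr_arrow k) = src (loop_of (src k)).
Proof. by rewrite iarr_arrowP -iarr_loopP. Qed.

Fact const_arrow_tgt (k : arr (inertia G)) :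
  tgt (iarr_arrow k) = src (loop_of (tgt k)).
Proof.
by rewrite src_conjug//; [exact: iarr_loopP|exact: iarr_arrowP].
Qed.

Fact const_arrow_end (k : arr (inertia G)) :
  mul (iarr_arrow k) (loop_of (tgt k)) = mul (loop_of (src k)) (iarr_arrow k).
Proof.
have aP := iarr_arrowP k; have vP := iarr_loopP k.
rewrite [loop_of (tgt k)]/(conjug _ _) /conjug mulA ?src_inv//; last first.
  by rewrite tgt_inv src_mul// vP.
by rewrite mul_invr aP -vP -[X in mul (idn X)](@src_mul _ _ _ (iarr_arrow k))// mul_idnl.
Qed.

Definition const_arrow (k : arr (inertia G)) :
    loop_arrow (const_loop (src k)) (const_loop (tgt k)) :=
  @LoopArrow (const_loop (src k)) (const_loop (tgt k)) (fun _ => iarr_arrow k)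
    (fun t _ => const_arrow_smooth _ t) (fun _ _ => const_arrow_src k)
    (fun _ _ => const_arrow_tgt k) (const_arrow_end k).

Definition const_holonomy (k : arr (inertia G)) : R[i] :=
  holonomy (const_arrow k).

(* The differential of the inclusion of constant loops sends the tangent
   vector w of the inertia groupoid to (xi_1, xi(1)) = (ds(w), w). *)
Definition is_const_vector (g : R -> obj (inertia G))
    (xi : loop_vector (const_loop (g 0))) : Prop :=
  (forall t : R, 0 <= t <= 1 -> same_velocity (lv_path xi t) (fun s => src (loop_of (g s)))) /\
  same_velocity (lv_end xi) (fun s => loop_of (g s)).

Definition is_const_connection (omega : form1 (obj (inertia G))) : Prop :=
  forall g, smooth_curve g ->
  forall xi : loop_vector (const_loop (g 0)), is_const_vector xi ->
  omega g = holonomy_connection xi.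

End Loops.

(* Main.v *)
From HB Require Import structures.
Require Import Defs.
From mathcomp Require Import all_boot all_order all_algebra.
From mathcomp Require Import all_classical all_reals all_analysis.
From mathcomp Require Import complex ring lra.

(* On smooth curves, [omega] is [A] pulled back along the inclusion of loops
   (the integral of [B] vanishes on constant loops), and
   [f(v, a) = h(v, a) / h(a, a^-1 v a)]. The cocycle condition makes [f]
   multiplicative, hence [f(k^-1) = f(k)^-1], and gives
   [h(e, a) = h(e, e)] and [h(a, e) = h(e, e)] for units [e], so that [f] is
   trivialised over the units by [u(x) = h(e(x), e(x))^-1]. The equation for
   [d log h] at [(v, a)] and at [(a, a^-1 v a)] gives the one for [d log f], since
   both pairs have the same product. Finally [d omega] is the restriction of
   [dA = t^*B - s^*B], and [s = t] on loops.

   The smooth structures are those of slice charts, so one must show that pairs of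
   smooth maps into composable arrows are smooth, and that the source and the
   target of a smooth curve of arrows of the inertia groupoid are smooth curves of
   loops. For the latter, a slice chart of the arrows at [(v, a)] makes the loops a
   smooth neighbourhood retract at [v] and at [a^-1 v a]; by the inverse function
   theorem, retracts have slice charts. *)

Import Order.TTheory GRing.Theory Num.Theory.
Import numFieldNormedType.Exports.
(* Some names of the definitions, e.g. [mul], clash with library ones. *)
Import Defs.

(** * Functions of class C^k *)

(** The form [omega] is determined only on curves that are smooth for the slice atlas of the loops,
    so the equation for [d log f] cannot even be stated in terms of [A] until the two end curves of
    a curve of arrows are known to have slice charts. Linearising finite isotropy groups would
    produce charts everywhere; the route taken needs them only where a smooth curve of arrows
    passes. Smoothness at an arrow already includes a slice chart there, and it can be carried to
    both ends because source and target have local inverses. The inverse function theorem is proved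
    only for maps with identity differential, since straightening a retraction gives such a map.

    Smoothness is tested on maps out of normed spaces ([smooth_at]). Curves and inverse charts are
    both instances, so one set of lemmas serves the equations of forms, which are checked on curves,
    and the smoothness of functions, which is checked on inverse charts. *)

Section SmoothFunctions.
Local Set Implicit Arguments.
Local Unset Strict Implicit.
Local Open Scope classical_set_scope.
Local Open Scope ring_scope.
Local Open Scope complex_scope.
Variable R : realType.

Lemma cvg_shift0 (V : normedModType R) (x : V) :
  (h + x) @[h --> (0 : V)] --> x.
Proof.
rewrite -[X in _ --> X](add0r x).
by apply: cvgD; [exact: cvg_id|exact: cvg_cst].
Qed.

(** A first-order expansion at [x] sees only the germ there, so [f] and [g] share it; uniqueness of
    the differential does the rest. *)
Lemma near_eq_differentiable (V W : normedModType R) (f g : V -> W) (x : V) :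
  (\near x, f x = g x) -> differentiable f x -> differentiable g x.
Proof.
move=> fg df; have fgx : f x = g x by exact: nbhs_singleton fg.
have dcf : continuous ('d f x) by exact: diff_continuous.
have gE : g \o shift x = cst (g x) + 'd f x +o_ 0 id.
  apply/eqaddoP => e e0.
  have /eqaddoP /(_ _ e0) := diff_locally df.
  have : \forall h \near (0 : V), f (h + x) = g (h + x).
    exact: (cvg_shift0 fg).
  apply: filterS2 => h /= fgh.
  by rewrite /GRing.add /GRing.opp /= fgh fgx.
apply/diff_locallyP.
have -> : 'd g x = 'd f x :> (V -> W) by exact: diff_unique.
by [].
Qed.

Lemma Ck_sub (V W : normedModType R) k (U U' : set V) (f : V -> W) :
  U' `<=` U -> Ck k U f -> Ck k U' f.
Proof.
move=> U'U; elim: k f => [|k IHk] f /=; first by move=> cf x /U'U /cf.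
by move=> [df Df]; split=> [x /U'U /df|v]//; exact: IHk.
Qed.

Lemma Ck_local (V W : normedModType R) k (U : set V) (f : V -> W) :
  (forall x, U x -> exists N, [/\ open N, N x & Ck k N f]) -> Ck k U f.
Proof.
elim: k f => [|k IHk] f /= loc.
  by move=> x /loc[N [_ Ox]]; exact.
split=> [x /loc[N [_ Ox [+ _]]]|v]; first exact.
by apply: IHk => x /loc[N [oN Ox [_ /(_ v)]]]; exists N.
Qed.

(** Openness of [U] turns agreement on [U] into agreement of germs, hence of all derivatives. Most
    proofs below use this to replace a function by a formula for it. *)
Lemma Ck_eq (V W : normedModType R) k (U : set V) (f g : V -> W) :
  open U -> (forall x, U x -> f x = g x) -> Ck k U f -> Ck k U g.
Proof.
move=> oU; elim: k f g => [|k IHk] f g fg /=.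
  move=> cf x Ux; apply: (cvg_trans _ (_ : f @ x --> g x)).
    apply: near_eq_cvg; near=> y; apply/fg; near: y.
    exact: open_nbhs_nbhs.
  by rewrite -fg//; exact: cf.
have near_fg x : U x -> \near x, f x = g x.
  by move=> Ux; apply: filterS fg _; exact: open_nbhs_nbhs.
move=> [df Df]; split=> [x Ux|v].
  by apply: near_eq_differentiable (df x Ux); exact: near_fg.
apply: IHk (Df v) => x Ux; apply: near_eq_derive; exact: near_fg.
Unshelve. all: by end_near. Qed.

Lemma CkW (V W : normedModType R) k (U : set V) (f : V -> W) :
  Ck k.+1 U f -> Ck k U f.
Proof.
elim: k f => [|k IHk] f [df Df].
  by move=> x /df /differentiable_continuous.
by split=> // v; exact: IHk.
Qed.

Lemma Ck_cst (V W : normedModType R) k (U : set V) (a : W) :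
  Ck k U (fun=> a).
Proof. exact: Cinf_cst. Qed.

Lemma CkD (V W : normedModType R) k (U : set V) (f g : V -> W) :
  open U -> Ck k U f -> Ck k U g -> Ck k U (fun x => f x + g x).
Proof.
move=> oU; elim: k f g => [|k IHk] f g /=.
  by move=> cf cg x Ux; apply: cvgD; [exact: cf|exact: cg].
move=> [df Df] [dg Dg]; split=> [x Ux|v].
  by apply: differentiableD; [exact: df|exact: dg].
apply: (Ck_eq oU _ (IHk _ _ (Df v) (Dg v))) => x Ux.
by rewrite -deriveD//; apply: diff_derivable; [exact: df|exact: dg].
Qed.

Lemma Ck_sum (V W : normedModType R) k (U : set V) I (s : seq I) (P : pred I)
    (f : I -> V -> W) :
  open U -> (forall i, Ck k U (f i)) -> Ck k U (fun x => \sum_(i <- s | P i) f i x).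
Proof.
move=> oU Cf; elim: s => [|i s IHs].
  by apply: (Ck_eq oU _ (Ck_cst k U 0)) => x _; rewrite big_nil.
case Pi: (P i).
  by apply: (Ck_eq oU _ (CkD oU (Cf i) IHs)) => x _; rewrite big_cons Pi.
by apply: (Ck_eq oU _ IHs) => x _; rewrite big_cons Pi.
Qed.

Lemma Ck_linear (V W W' : normedModType R) k (U : set V) (L : {linear W -> W'})
    (f : V -> W) :
  continuous L -> open U -> Ck k U f -> Ck k U (L \o f).
Proof.
move=> cL oU; elim: k f => [|k IHk] f /=.
  by move=> cf x Ux; apply: continuous_comp; [exact: cf|exact: cL].
have dL y : differentiable L y by exact: linear_differentiable.
move=> [df Df]; split=> [x Ux|v].
  by apply: differentiable_comp; [exact: df|exact: dL].
apply: (Ck_eq oU _ (IHk _ (Df v))) => x Ux /=.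
rewrite [RHS]deriveE; last by apply: differentiable_comp; [exact: df|exact: dL].
by rewrite diff_comp//; [rewrite /= diff_lin// deriveE//|]; exact: df.
Qed.

(** The product rule multiplies derivatives by the undifferentiated factors, so the induction also
    uses those at order [k], through [CkW]. *)
Lemma CkM (V : normedModType R) k (U : set V) (f g : V -> R^o) :
  open U -> Ck k U f -> Ck k U g -> Ck k U (fun x => f x * g x : R^o).
Proof.
move=> oU; elim: k f g => [|k IHk] f g.
  by move=> cf cg x Ux; apply: cvgM; [exact: cf|exact: cg].
move=> Cf Cg; have [df Df] := Cf; have [dg Dg] := Cg; split=> [x Ux|v].
  by apply: (@differentiableM R V f g); [exact: df|exact: dg].
apply: (Ck_eq oU _ (CkD oU (IHk _ _ (CkW Cf) (Dg v))
                           (IHk _ _ (CkW Cg) (Df v)))) => x Ux.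
by rewrite -[RHS](esym (@deriveM R V f g x v _ _))//; apply: diff_derivable;
  [exact: df|exact: dg].
Qed.

Lemma CkV (V : normedModType R) k (U : set V) (f : V -> R^o) :
  open U -> (forall x, U x -> f x != 0) -> Ck k U f ->
  Ck k U (fun x => (f x)^-1 : R^o).
Proof.
move=> oU f0; elim: k => [|k IHk].
  by move=> cf x Ux; apply: cvgV; [exact: f0|exact: cf].
move=> Cf; have [df Df] := Cf; have CV := IHk (CkW Cf); split=> [x Ux|v].
  by apply: (@differentiableV R V f); [exact: df|exact: f0].
(* The derivative of [1/f] is [- (1/f)^2 f']: it involves [1/f] only at order [k], where the
   induction hypothesis applies. *)
have C1 := CkM oU (@Ck_cst V R^o k U (-1)) (CkM oU (CkM oU CV CV) (Df v)).
apply: (Ck_eq oU _ C1) => x Ux.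
rewrite (@deriveV R V f x v (f0 x Ux)); last exact/diff_derivable/df.
by rewrite mulN1r -mulNr -invfM.
Qed.

Lemma Ck_coord (V : normedModType R) k (U : set V) n (f : V -> 'rV[R]_n) i :
  open U -> Ck k U f -> Ck k U (fun x => f x 0 i : R^o).
Proof.
move=> oU Cf.
have @L : {linear 'rV[R]_n -> R^o}.
  by exists (fun N : 'rV[R]_n => N 0 i); do 2![eexists]; do ?[constructor];
     rewrite ?mxE// => ? *; rewrite ?mxE//; move=> ?; rewrite !mxE.
by apply: (@Ck_linear V 'rV[R]_n R^o k U L f) => //; exact: coord_continuous.
Qed.

Lemma Ck_rowP (V : normedModType R) k (U : set V) n (f : V -> 'rV[R]_n) :
  open U -> (forall i, Ck k U (fun x => f x 0 i : R^o)) -> Ck k U f.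
Proof.
move=> oU Cf.
have @L (i : 'I_n) : {linear R^o -> 'rV[R]_n}.
  exists (fun a : R^o => a *: delta_mx 0 i); do 2![eexists]; do ?[constructor].
  - by rewrite scale0r.
  - by move=> a b; rewrite scalerDl.
  - by move=> a b; rewrite scalerA.
apply: (@Ck_eq _ _ _ _ (fun x => \sum_(i < n) (L i \o (fun x => f x 0 i : R^o)) x)).
- by [].
- by move=> x Ux; rewrite [RHS]row_sum_delta.
- apply: Ck_sum => // i; apply: Ck_linear => //.
  exact: scalel_continuous.
Qed.

Lemma derive_comp_row (V : normedModType R) n (f : V -> 'rV[R]_n)
    (g : 'rV[R]_n -> R^o) (x v : V) :
  differentiable f x -> differentiable g (f x) ->
  'D_v (g \o f) x = \sum_(i < n) ('D_v f x) 0 i * 'D_(delta_mx 0 i) g (f x).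
Proof.
move=> df dg; rewrite deriveE; last exact: differentiable_comp.
rewrite diff_comp// [LHS]/= -(deriveE v df).
rewrite [in LHS](row_sum_delta ('D_v f x)) linear_sum.
apply: eq_bigr => i _; rewrite linearZ (deriveE _ dg); reflexivity.
Qed.

(** Induction on [k] for all [g] at once: by the chain rule a derivative of [g \o f] is a sum of
    products of a coordinate of a derivative of [f] with a partial derivative of [g] composed with
    [f]. *)
Lemma Ck_comp (V : normedModType R) k n (U : set V) (U' : set 'rV[R]_n)
    (f : V -> 'rV[R]_n) (g : 'rV[R]_n -> R^o) :
  open U -> (forall x, U x -> U' (f x)) -> Ck k U f -> Ck k U' g ->
  Ck k U (g \o f).
Proof.
move=> oU fU; elim: k g => [|k IHk] g.
  move=> cf cg x Ux; apply: continuous_comp; first exact: cf.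
  by apply: cg; exact: fU.
move=> Cf Cg; have [df Df] := Cf; have [dg Dg] := Cg; split=> [x Ux|v].
  by apply: differentiable_comp; [exact: df|exact: dg (fU x Ux)].
apply: (@Ck_eq _ _ _ _ (fun x => \sum_(i < n)
    (('D_v f x) 0 i * ('D_(delta_mx 0 i) g \o f) x : R^o))) => //.
  by move=> x Ux; rewrite [RHS]derive_comp_row//; [exact: df|exact: dg (fU x Ux)].
apply: Ck_sum => // i; apply: CkM => //; first exact: (Ck_coord i oU (Df v)).
by apply: IHk; [exact: CkW|exact: Dg].
Qed.

Lemma Ck_comp_row (V : normedModType R) k n m (U : set V) (U' : set 'rV[R]_n)
    (f : V -> 'rV[R]_n) (g : 'rV[R]_n -> 'rV[R]_m) :
  open U -> open U' -> (forall x, U x -> U' (f x)) -> Ck k U f -> Ck k U' g ->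
  Ck k U (g \o f).
Proof.
move=> oU oU' fU Cf Cg; apply: Ck_rowP => // i.
apply: (@Ck_comp V k n U U' f (fun y => g y 0 i)) => //.
exact: Ck_coord.
Qed.

Lemma Cinf_local (V W : normedModType R) (U : set V) (f : V -> W) :
  (forall x, U x -> exists N, [/\ open N, N x & Cinf N f]) -> Cinf U f.
Proof.
move=> loc k; apply: Ck_local => x /loc[N [oN Nx CN]].
by exists N; split=> //; exact: CN.
Qed.

Lemma Cinf_continuous (V W : normedModType R) (U : set V) (f : V -> W) x :
  Cinf U f -> U x -> {for x, continuous f}.
Proof. by move=> Cf; exact: (Cf 0). Qed.

Lemma Cinf_differentiable (V W : normedModType R) (U : set V) (f : V -> W) x :
  Cinf U f -> U x -> differentiable f x.
Proof. by move=> Cf; exact: (Cf 1%N).1. Qed.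

Lemma Cinf_id (V : normedModType R) (U : set V) : Cinf U (@id V).
Proof.
case=> [|k]; first by move=> x _; exact: cvg_id.
split=> [x _|v]; first by have [] := is_diff_id x.
have -> : 'D_v (@id V) = (fun=> v) by apply/funext => x; rewrite derive_id.
exact: Ck_cst.
Qed.

Lemma Cinf_row_mx (V : normedModType R) n m (U : set V) (f : V -> 'rV[R]_n)
    (g : V -> 'rV[R]_m) :
  open U -> Cinf U f -> Cinf U g -> Cinf U (fun x => row_mx (f x) (g x)).
Proof.
move=> oU Cf Cg k; apply: Ck_rowP => // i; rewrite -(@fintype.splitK n m i).
case: (fintype.split i) => j /=.
  apply: (Ck_eq oU _ (Ck_coord j oU (Cf k))) => x _; by rewrite row_mxEl.
apply: (Ck_eq oU _ (Ck_coord j oU (Cg k))) => x _; by rewrite row_mxEr.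
Qed.

Lemma Cinf_lsubmx (V : normedModType R) n m (U : set V) (f : V -> 'rV[R]_(n + m)) :
  open U -> Cinf U f -> Cinf U (fun x => lsubmx (f x)).
Proof.
move=> oU Cf k; apply: Ck_rowP => // i.
by apply: (Ck_eq oU _ (Ck_coord (lshift m i) oU (Cf k))) => x _; rewrite mxE.
Qed.

Lemma Cinf_rsubmx (V : normedModType R) n m (U : set V) (f : V -> 'rV[R]_(n + m)) :
  open U -> Cinf U f -> Cinf U (fun x => rsubmx (f x)).
Proof.
move=> oU Cf k; apply: Ck_rowP => // i.
by apply: (Ck_eq oU _ (Ck_coord (rshift n i) oU (Cf k))) => x _; rewrite mxE.
Qed.

Lemma Cinf_pad (V : normedModType R) n m (U : set V) (f : V -> 'rV[R]_n) :
  open U -> Cinf U f -> Cinf U (fun x => pad m (f x)).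
Proof.
move=> oU Cf k; apply: Ck_rowP => // i.
case: (@insubP _ _ 'I_n (i : nat)) => [j _ ij|ni].
  apply: (Ck_eq oU _ (Ck_coord j oU (Cf k))) => x _.
  by rewrite mxE -ij valK.
apply: (Ck_eq oU _ (@Ck_cst V R^o k U 0)) => x _.
by rewrite mxE insubN.
Qed.

Lemma CinfB (V : normedModType R) n (U : set V) (f g : V -> 'rV[R]_n) :
  open U -> Cinf U f -> Cinf U g -> Cinf U (fun x => f x - g x).
Proof.
move=> oU Cf Cg k; apply: CkD => //.
apply: Ck_rowP => // i.
apply: (Ck_eq oU _ (CkM oU (@Ck_cst V R^o k U (-1)) (Ck_coord i oU (Cg k)))).
by move=> x _; rewrite mulN1r mxE.
Qed.

Lemma CinfD (V W : normedModType R) (U : set V) (f g : V -> W) :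
  open U -> Cinf U f -> Cinf U g -> Cinf U (fun x => f x + g x).
Proof. by move=> oU Cf Cg k; exact: CkD. Qed.

(** * Complex-valued smooth functions *)

Lemma cCinf_local (V : normedModType R) (U : set V) (f : V -> R[i]) :
  (forall x, U x -> exists N, [/\ open N, N x & cCinf N f]) -> cCinf U f.
Proof.
by move=> loc; split; apply: Cinf_local => x /loc[N [oN Nx [? ?]]]; exists N.
Qed.

Lemma cCinf_sub (V : normedModType R) (U U' : set V) (f : V -> R[i]) :
  U' `<=` U -> cCinf U f -> cCinf U' f.
Proof. by move=> U'U [CR CI]; split=> k; exact: (Ck_sub U'U). Qed.

Lemma cCinf_comp (V : normedModType R) n (U : set V) (U' : set 'rV[R]_n)
    (f : V -> 'rV[R]_n) (g : 'rV[R]_n -> R[i]) :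
  open U -> (forall x, U x -> U' (f x)) -> Cinf U f -> cCinf U' g ->
  cCinf U (g \o f).
Proof.
move=> oU fU Cf [CR CI]; split=> k.
  exact: (Ck_comp oU fU (Cf k) (CR k)).
exact: (Ck_comp oU fU (Cf k) (CI k)).
Qed.

Lemma cCinf_eq (V : normedModType R) (U : set V) (f g : V -> R[i]) :
  open U -> (forall x, U x -> f x = g x) -> cCinf U f -> cCinf U g.
Proof.
move=> oU fg [CR CI]; split=> k.
  by apply: (Ck_eq oU _ (CR k)) => x /fg ->.
by apply: (Ck_eq oU _ (CI k)) => x /fg ->.
Qed.

Lemma cCinfM (V : normedModType R) (U : set V) (f g : V -> R[i]) :
  open U -> cCinf U f -> cCinf U g -> cCinf U (fun x => f x * g x).
Proof.
move=> oU [fR fI] [gR gI]; split=> k.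
  apply: (Ck_eq oU _ (CkD oU (CkM oU (fR k) (gR k))
    (CkM oU (@Ck_cst V R^o k U (-1)) (CkM oU (fI k) (gI k))))) => x _.
  by rewrite mulN1r; case: (f x) (g x) => a b [c d].
apply: (Ck_eq oU _ (CkD oU (CkM oU (fR k) (gI k)) (CkM oU (fI k) (gR k)))) => x _.
by case: (f x) (g x) => a b [c d].
Qed.

Lemma cCinfV (V : normedModType R) (U : set V) (f : V -> R[i]) :
  open U -> (forall x, U x -> f x != 0) -> cCinf U f ->
  cCinf U (fun x => (f x)^-1).
Proof.
move=> oU f0 [fR fI].
(* The squared modulus: the inverse of a complex number is its conjugate divided by this. *)
pose n2 x : R^o := complex.Re (f x) * complex.Re (f x) + complex.Im (f x) * complex.Im (f x).
have n20 x : U x -> n2 x != 0.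
  move=> /f0; rewrite /n2; case: (f x) => a b; rewrite eq_complex /=.
  by rewrite paddr_eq0 -?expr2 ?sqr_ge0// !expf_eq0.
have Cn k : Ck k U (fun x => (n2 x)^-1 : R^o).
  apply: CkV => //; apply: (CkD oU); apply: CkM => //; by [exact: fR|exact: fI].
split=> k.
  by apply: (Ck_eq oU _ (CkM oU (fR k) (Cn k))) => x _; rewrite /n2; case: (f x).
apply: (Ck_eq oU _ (CkM oU (@Ck_cst V R^o k U (-1)) (CkM oU (fI k) (Cn k)))) => x _.
by rewrite /n2 mulN1r; case: (f x).
Qed.

Lemma cderiveM (V : normedModType R) (f g : V -> R[i]) (U : set V) (x v : V) :
  U x -> cCinf U f -> cCinf U g ->
  cderive v (fun y => f y * g y) x = cderive v f x * g x + f x * cderive v g x.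
Proof.
move=> Ux [fR fI] [gR gI].
have d (F : V -> R^o) : Cinf U F -> derivable F x v.
  by move=> CF; exact: diff_derivable (Cinf_differentiable CF Ux).
have dfR := d _ fR; have dfI := d _ fI; have dgR := d _ gR; have dgI := d _ gI.
pose fr y : R := complex.Re (f y); pose fi y : R := complex.Im (f y).
pose gr y : R := complex.Re (g y); pose gi y : R := complex.Im (g y).
have DR := @is_deriveB R V R^o _ _ x v _ _
  (@is_deriveM R V fr gr x v _ _ (derivableP dfR) (derivableP dgR))
  (@is_deriveM R V fi gi x v _ _ (derivableP dfI) (derivableP dgI)).
have DI := @is_deriveD R V R^o _ _ x v _ _
  (@is_deriveM R V fr gi x v _ _ (derivableP dfR) (derivableP dgI))
  (@is_deriveM R V fi gr x v _ _ (derivableP dfI) (derivableP dgR)).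
rewrite /cderive.
have -> : (fun y => complex.Re (f y * g y) : R^o) = (fr * gr - fi * gi : V -> R^o).
  by apply/funext => y; rewrite /GRing.mul/GRing.add/GRing.opp/= /fr /fi /gr /gi;
    case: (f y) (g y) => a b [c e].
have -> : (fun y => complex.Im (f y * g y) : R^o) = (fr * gi + fi * gr : V -> R^o).
  by apply/funext => y; rewrite /GRing.mul/GRing.add/= /fr /fi /gr /gi;
    case: (f y) (g y) => a b [c e].
rewrite (@derive_val _ _ _ _ _ _ _ DR) (@derive_val _ _ _ _ _ _ _ DI) /fr /fi /gr /gi.
move: ('D_v _ x) ('D_v _ x) ('D_v _ x) ('D_v _ x) => p q r s.
case: (f x) (g x) => a b [c e].
apply/eqP; rewrite eq_complex /=; apply/andP; split; apply/eqP;
  rewrite /GRing.scale/=; ring.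
Qed.

Lemma near_eq_cderive (V : normedModType R) (f g : V -> R[i]) (x v : V) :
  (\near x, f x = g x) -> cderive v f x = cderive v g x.
Proof.
move=> fg; rewrite /cderive; congr (_ +i* _); apply: near_eq_derive;
  by apply: filterS fg => y ->.
Qed.

End SmoothFunctions.

(** * Smooth maps between charted spaces *)

Section SmoothMaps.
Local Set Implicit Arguments.
Local Unset Strict Implicit.
Local Open Scope classical_set_scope.
Local Open Scope ring_scope.
Local Open Scope complex_scope.
Variable R : realType.

(* [smooth_at] at [V := R^o] is convertible to [smooth_curve_at]. *)
Definition smooth_at (V : normedModType R) (M : smooth_space R) (g : V -> M)
    (x : V) : Prop :=
  exists c, [/\ @atlas R M c, cdom c (g x) &
    exists N : set V, [/\ open N, N x, (forall y, N y -> cdom c (g y)) &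
      Cinf N (fun y => cmap c (g y))]].

Lemma open_setX (X Y : topologicalType) (A : set X) (B : set Y) :
  open A -> open B -> open (A `*` B).
Proof.
move=> oA oB; rewrite openE => -[x y] [/= Ax By].
by exists (A, B) => //; split; exact: open_nbhs_nbhs.
Qed.

Lemma open_preimage_in (X Y : topologicalType) (U : set X) (T : set Y) (f : X -> Y) :
  open U -> (forall x, U x -> {for x, continuous f}) -> open T ->
  open [set x | U x /\ T (f x)].
Proof.
move=> oU cf oT; rewrite openE => x [Ux Tfx].
apply: filterI; first exact: open_nbhs_nbhs.
by apply: (cf x Ux); exact: open_nbhs_nbhs.
Qed.

Lemma open_transition (M : topologicalType) (c d : chart R M) :
  is_chart c -> open (cdom d) -> open [set p | @crng _ _ c p /\ cdom d (cinv p)].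
Proof. by move=> [_ ? _ _ [_ ?]] ?; exact: open_preimage_in. Qed.

Lemma smooth_at_transition (V : normedModType R) (M : topologicalType)
    (c d : chart R M) (N : set V) (g : V -> M) :
  is_chart c -> open (cdom d) -> smooth_transition c d -> open N ->
  (forall y, N y -> cdom c (g y)) -> Cinf N (fun y => cmap c (g y)) ->
  open [set y | N y /\ cdom d (g y)] /\
  Cinf [set y | N y /\ cdom d (g y)] (fun y => cmap d (g y)).
Proof.
move=> hc od cd oN Nc CN; have oT := open_transition hc od.
have [_ _ dr _ _] := hc.
(* Continuity of [g] is not assumed, so openness is obtained in coordinates, as a preimage under
   [cmap c (g y)]. *)
have E : [set y | N y /\ cdom d (g y)] = [set y | N y /\
    [set p | @crng _ _ c p /\ cdom d (cinv p)] (cmap c (g y))].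
  apply/seteqP; split=> y /= [Ny].
    by move=> dy; split=> //; have [? ->] := dr _ (Nc _ Ny).
  by case=> _; have [_ ->] := dr _ (Nc _ Ny).
have oN' : open [set y | N y /\ cdom d (g y)].
  rewrite E; apply: open_preimage_in => // y Ny.
  exact: (Cinf_continuous CN).
split=> // k.
apply: (@Ck_eq _ _ _ _ _ ((fun p => cmap d (@cinv _ _ c p)) \o (fun y => cmap c (g y)))).
- by [].
- by move=> y [Ny _] /=; have [_ ->] := dr _ (Nc _ Ny).
- apply: (Ck_comp_row oN' oT _ _ (cd k)).
    by move=> y; rewrite E => -[].
  by apply: Ck_sub (CN k) => y [].
Qed.

Lemma manifold_chart (M : smooth_space R) (c : chart R M) :
  is_manifold M -> atlas c -> is_chart c.
Proof. by case=> _ _ _ + _ => /[apply] -[]. Qed.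

Lemma manifold_compatible (M : smooth_space R) (c d : chart R M) :
  is_manifold M -> atlas c -> atlas d -> smooth_transition c d.
Proof. by case=> _ _ _ + _ => /[apply] -[_] /[apply] -[]. Qed.

(** Charts of a manifold are compatible, so the chart witnessing smoothness can be traded for any
    other at the point. A slice atlas comes with no such guarantee. *)
Lemma smooth_atE (V : normedModType R) (M : smooth_space R) (g : V -> M) (x : V)
    (d : chart R M) :
  is_manifold M -> atlas d -> smooth_at g x -> cdom d (g x) ->
  exists N : set V, [/\ open N, N x, (forall y, N y -> cdom d (g y)) &
    Cinf N (fun y => cmap d (g y))].
Proof.
move=> mM ad [c [ac cx [N [oN Nx Nc CN]]]] dx.
have hc := manifold_chart mM ac.
have [od _ _ _ _] := manifold_chart mM ad.
have [oN' CN'] := smooth_at_transition hc od (manifold_compatible mM ac ad) oN Nc CN.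
by exists [set y | N y /\ cdom d (g y)]; split=> // y [].
Qed.

Lemma smooth_at_continuous (V : normedModType R) (M : smooth_space R)
    (g : V -> M) (x : V) :
  (forall c, @atlas R M c -> is_chart c) -> smooth_at g x -> {for x, continuous g}.
Proof.
move=> hM [c [/hM[_ _ dr _ [_ ci]] cx [N [oN Nx Nc CN]]]].
apply: (cvg_trans _ (_ : (@cinv _ _ c \o (fun y => cmap c (g y))) @ x --> g x)).
  apply: near_eq_cvg; apply: filterS (open_nbhs_nbhs (conj oN Nx)) => y Ny /=.
  by have [_ ->] := dr _ (Nc _ Ny).
have [rx ex] := dr _ cx; rewrite -[X in _ --> X]ex.
apply: (@continuous_comp _ _ _ (fun y => cmap c (g y)) (@cinv _ _ c)).
  exact: (Cinf_continuous CN).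
exact: ci.
Qed.


(** What moving smooth maps through charts requires. Covering, compatibility and maximality are left
    out, so that the slice atlas of an arbitrary subset qualifies. *)
Definition charted (M : smooth_space R) : Prop :=
  forall c, @atlas R M c -> [/\ open (@crng _ _ c),
    (forall x, cdom c x -> crng (cmap c x) /\ cinv (cmap c x) = x) &
    (forall p, @crng _ _ c p -> cdom c (cinv p) /\ cmap c (cinv p) = p)].

Lemma manifold_charted (M : smooth_space R) : is_manifold M -> charted M.
Proof. by move=> mM c /(manifold_chart mM)[]. Qed.

Lemma prod_space_charted (M N : smooth_space R) : charted (prod_space M N).
Proof. by move=> c [[]]. Qed.

Lemma padK k n (q : 'rV[R]_n) : (n <= k)%N -> pad n (pad k q) = q.
Proof.
move=> nk; apply/rowP => i; rewrite mxE insubT; first exact: leq_trans nk.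
by move=> lik; rewrite mxE /= valK.
Qed.

Lemma pad_trunc k n (q : 'rV[R]_k) : (n <= k)%N ->
  (forall i : 'I_k, (n <= i)%N -> q 0 i = 0) -> pad k (pad n q) = q.
Proof.
move=> nk q0; apply/rowP => i; rewrite mxE; case: insubP => [j jn ij|].
  by rewrite mxE insubT ?ij// => lik; congr (q 0 _); exact: val_inj.
by rewrite -leqNgt => /q0 ->.
Qed.

Lemma padD k n (p q : 'rV[R]_k) : pad n (p + q) = pad n p + pad n q.
Proof. by apply/rowP => i; rewrite !mxE; case: insubP => *; rewrite ?mxE ?addr0. Qed.

Lemma padZ k n a (q : 'rV[R]_k) : pad n (a *: q) = a *: pad n q.
Proof. by apply/rowP => i; rewrite !mxE; case: insubP => *; rewrite ?mxE ?mulr0. Qed.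

Lemma pad_continuous k n : continuous (@pad R k n).
Proof.
move=> p; have := Cinf_pad n openT (@Cinf_id R 'rV[R]_k setT).
by move=> /Cinf_continuous; exact.
Qed.

Lemma slice_cmap (M : smooth_space R) (S : set M) (c : chart R M) (d : chart R S)
    (x : S) : slice_of c d -> cdom d x -> cmap c (set_val x) = pad _ (cmap d x).
Proof.
move=> [dc Sc cd _ [md _]] dx; rewrite md// pad_trunc// => i di.
by apply: ((Sc _ _).1 (set_mem (valP x))) => //; apply/cd.
Qed.

Lemma sub_space_charted (M : smooth_space R) (S : set M) :
  charted M -> charted (@sub_space R M S).
Proof.
move=> hM d [c /hM[oc dr rd] sl]; have [le Sc cd rc [md id]] := sl.
split.
- rewrite (_ : @crng _ _ d = @pad R _ _ @^-1` @crng _ _ c); last first.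
    by apply/seteqP; split=> q /rc.
  by apply: open_comp => // p _; exact: pad_continuous.
- move=> x dx; have cx := (cd x).1 dx; have [rx ex] := dr _ cx.
  have rdx : crng (cmap d x) by apply/rc; rewrite -(slice_cmap sl dx).
  split=> //; apply: val_inj; rewrite /= [LHS](id _ rdx).
  by rewrite -(slice_cmap sl dx).
- move=> q dq; have [cq eq] := rd _ ((rc q).1 dq).
  have dx : cdom d (cinv q) by apply/cd; rewrite id.
  by split=> //; rewrite md// id// eq padK.
Qed.

Lemma smooth_at_comp (V : normedModType R) (M M' : smooth_space R) (U : set M)
    (f : M -> M') (g : V -> M) (x : V) :
  charted M -> smooth_on U f -> U (g x) -> smooth_at g x -> smooth_at (f \o g) x.
Proof.
move=> hM sf Ux [c [ac cx [N [oN Nx Nc CN]]]].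
have [d [ad dx [W [oW Wx Wc Wd CW]]]] := sf _ Ux _ ac cx.
have [_ dr _] := hM _ ac.
have oN' : open [set y | N y /\ W (cmap c (g y))].
  by apply: open_preimage_in => // y Ny; exact: (Cinf_continuous CN).
exists d; split=> //; exists [set y | N y /\ W (cmap c (g y))]; split=> //.
  by move=> y [Ny /Wd]; have [_ ->] := dr _ (Nc _ Ny).
move=> k.
apply: (@Ck_eq _ _ _ _ _ ((fun p => cmap d (f (@cinv _ _ c p))) \o (fun y => cmap c (g y)))).
- by [].
- by move=> y [Ny _] /=; have [_ ->] := dr _ (Nc _ Ny).
- apply: (Ck_comp_row oN' oW _ _ (CW k)); first by move=> y [].
  by apply: Ck_sub (CN k) => y [].
Qed.

Lemma csmooth_at (V : normedModType R) (M : smooth_space R) (F : M -> R[i])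
    (g : V -> M) (x : V) :
  charted M -> csmooth F -> smooth_at g x ->
  exists N : set V, [/\ open N, N x & cCinf N (F \o g)].
Proof.
move=> hM sF [c [ac cx [N [oN Nx Nc CN]]]]; exists N; split=> //.
have [_ dr _] := hM _ ac.
apply: (cCinf_eq oN _ (cCinf_comp oN _ CN (sF _ ac))).
  by move=> y Ny /=; have [_ ->] := dr _ (Nc _ Ny).
by move=> y Ny; have [] := dr _ (Nc _ Ny).
Qed.

(** Inverse charts are themselves smooth parametrisations, so testing on parametrisations covers the
    definition of [csmooth]. *)
Lemma csmooth_of_smooth_at (M : smooth_space R) (F : M -> R[i]) :
  charted M ->
  (forall n (g : 'rV[R]_n -> M) x, smooth_at g x ->
     exists N : set 'rV[R]_n, [/\ open N, N x & cCinf N (F \o g)]) ->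
  csmooth F.
Proof.
move=> hM hF c ac; have [oc _ rd] := hM _ ac.
apply: cCinf_local => p rp.
apply: (hF _ (fun p => @cinv _ _ c p)); exists c; split=> //.
  by have [] := rd _ rp.
exists (@crng _ _ c); split=> //; first by move=> y /rd[].
move=> k; apply: (Ck_eq oc _ (@Cinf_id _ _ _ k)) => y ry.
by have [_ ->] := rd _ ry.
Qed.

Lemma smooth_at_cinv (M : smooth_space R) (c : chart R M) (p : 'rV[R]_(cdim c)) :
  charted M -> atlas c -> crng p -> smooth_at (@cinv _ _ c) p.
Proof.
move=> hM ac rp; have [oc _ rd] := hM _ ac.
exists c; split=> //; first by have [] := rd _ rp.
exists (@crng _ _ c); split=> //; first by move=> y /rd[].
move=> k; apply: (Ck_eq oc _ (@Cinf_id _ _ _ k)) => y ry.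
by have [_ ->] := rd _ ry.
Qed.

Lemma smooth_at_reparam (V : normedModType R) n (M : smooth_space R)
    (g : 'rV[R]_n -> M) (f : V -> 'rV[R]_n) (N : set V) (x : V) :
  open N -> N x -> Cinf N f -> smooth_at g (f x) -> smooth_at (g \o f) x.
Proof.
move=> oN Nx CN [c [ac cx [W [oW Wx Wc CW]]]].
have oN' : open [set y | N y /\ W (f y)].
  by apply: open_preimage_in => // y Ny; exact: (Cinf_continuous CN).
exists c; split=> //; exists [set y | N y /\ W (f y)]; split=> //.
  by move=> y [_ /Wc].
move=> k; apply: (Ck_comp_row oN' oW _ _ (CW k)); first by move=> y [].
by apply: Ck_sub (CN k) => y [].
Qed.

Lemma smooth_at_val (V : normedModType R) (M : smooth_space R) (S : set M)
    (g : V -> @sub_space R M S) (x : V) :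
  smooth_at g x -> smooth_at (M := M) (fun y => set_val (g y)) x.
Proof.
move=> [d [[c ac sl] dx [N [oN Nx Nd CN]]]].
have [_ _ cd _ _] := sl.
exists c; split=> //; first exact/cd.
exists N; split=> //; first by move=> y /Nd /cd.
move=> k; have Cp := Cinf_pad (cdim c) oN CN; apply: (Ck_eq oN _ (Cp k)) => y Ny.
by rewrite (slice_cmap sl (Nd _ Ny)).
Qed.

(** A chart of the product need not be a product chart, but it is compatible with all of them; in a
    product chart the two components are the two blocks of coordinates. *)
Lemma smooth_at_pair (V : normedModType R) (M M' : smooth_space R)
    (g : V -> prod_space M M') (x : V) :
  is_manifold M -> is_manifold M' -> smooth_at g x ->
  smooth_at (M := M) (fun y => (g y).1) x /\ smooth_at (M := M') (fun y => (g y).2) x.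
Proof.
move=> mM mM' [C [[hC cC] Cx [N [oN Nx NC CN]]]].
have [_ _ cov _ _] := mM; have [_ _ cov' _ _] := mM'.
have [c ac cx] := cov (g x).1; have [d ad dx] := cov' (g x).2.
have [oc _ _ _ _] := manifold_chart mM ac.
have [od _ _ _ _] := manifold_chart mM' ad.
have oP : open (cdom (prod_chart c d)) by exact: open_setX.
have [oN' CN'] := smooth_at_transition hC oP (cC _ _ ac ad).1 oN NC CN.
split; [exists c|exists d]; split=> //;
  exists [set y | N y /\ cdom (prod_chart c d) (g y)]; split=> //.
- by move=> y [_ []].
- move=> k; apply: (Ck_eq oN' _ (Cinf_lsubmx oN' CN' k)) => y _.
  by rewrite row_mxKl.
- by move=> y [_ []].
- move=> k; apply: (Ck_eq oN' _ (Cinf_rsubmx oN' CN' k)) => y _.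
  by rewrite row_mxKr.
Qed.

Lemma local_diffeo_smooth (M M' : smooth_space R) (f : M -> M') :
  local_diffeo f -> smooth f.
Proof. by move=> ld x _; have [U [V [g [_ Ux _ _ [sf _]]]]] := ld x; exact: sf. Qed.

End SmoothMaps.

(** * Fibre products along local diffeomorphisms *)

Section FibreProducts.
Local Set Implicit Arguments.
Local Unset Strict Implicit.
Local Open Scope classical_set_scope.
Local Open Scope ring_scope.
Local Open Scope complex_scope.
Variable R : realType.

Lemma pad_row_mx n m (u : 'rV[R]_n) (v : 'rV[R]_m) : pad n (row_mx u v) = u.
Proof.
apply/rowP => i; rewrite mxE insubT; first exact: ltn_addr.
move=> lti; rewrite -[RHS](row_mxEl u v 0 i); congr (row_mx u v 0 _).
exact: val_inj.
Qed.

Lemma pad_row_mx0 n m (u : 'rV[R]_n) : pad (n + m) u = row_mx u 0.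
Proof.
apply/rowP => i; rewrite -(@fintype.splitK n m i).
case: (fintype.split i) => j /=; rewrite mxE.
  by rewrite row_mxEl insubT => [|lt]; [exact: (ltn_ord j)|congr (u 0 _); exact: val_inj].
by rewrite row_mxEr mxE insubN// -leqNgt leq_addr.
Qed.

Lemma cvg_row_mx (X : topologicalType) n m (f : X -> 'rV[R]_n) (g : X -> 'rV[R]_m) x :
  {for x, continuous f} -> {for x, continuous g} ->
  {for x, continuous (fun y => row_mx (f y) (g y))}.
Proof.
move=> cf cg.
have -> : (fun y => row_mx (f y) (g y)) =
    (fun y => row_mx (f y) (0 : 'rV[R]_m) + row_mx (0 : 'rV[R]_n) (g y)).
  by apply/funext => y; rewrite add_row_mx addr0 add0r.
have cl : continuous (fun u : 'rV[R]_n => row_mx u (0 : 'rV[R]_m)).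
  move=> u; have := Cinf_row_mx openT (@Cinf_id R 'rV[R]_n setT) (Cinf_cst setT (0 : 'rV[R]_m)).
  by move=> /Cinf_continuous; exact.
have cr : continuous (fun u : 'rV[R]_m => row_mx (0 : 'rV[R]_n) u).
  move=> u; have := Cinf_row_mx openT (Cinf_cst setT (0 : 'rV[R]_n)) (@Cinf_id R 'rV[R]_m setT).
  by move=> /Cinf_continuous; exact.
apply: cvgD.
  by apply: (@continuous_comp _ _ _ f (fun u => row_mx u 0)); [exact: cf|exact: cl].
by apply: (@continuous_comp _ _ _ g (fun u => row_mx 0 u)); [exact: cg|exact: cr].
Qed.

Lemma continuous_pair_for (X Y Z : topologicalType) (f : X -> Y) (g : X -> Z) x :
  {for x, continuous f} -> {for x, continuous g} ->
  {for x, continuous (fun y => (f y, g y))}.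
Proof. by move=> cf cg; exact: (cvg_pair cf cg). Qed.

(** The point [x0] is the default of [insubd], returned when the ambient inverse chart leaves
    [S]. *)
Definition slice_chart (M : smooth_space R) (S : set M) (C : chart R M) (n : nat)
    (x0 : S) : chart R S :=
  @Chart R S n [set x | cdom C (set_val x)] [set q | @crng _ _ C (pad _ q)]
    (fun x => pad n (cmap C (set_val x)))
    (fun q => insubd x0 (@cinv _ _ C (pad _ q))).

Lemma slice_chartP (M : smooth_space R) (S : set M) (C : chart R M) (n : nat)
    (x0 : S) : is_chart C -> (n <= cdim C)%N ->
  (forall x, cdom C x -> S x <-> forall i : 'I_(cdim C), (n <= i)%N -> cmap C x 0 i = 0) ->
  slice_of C (slice_chart C n x0).
Proof.
move=> [_ _ _ rd _] nC SC; split=> //; split=> // q /= rq.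
have [dq eq] := rd _ rq.
apply: insubdK; apply: mem_set; apply/SC => // i ni.
by rewrite eq mxE insubN// -leqNgt.
Qed.

Section Shear.
Variables (M M' : smooth_space R) (c : chart R M) (d : chart R M').
Variables (N : set 'rV[R]_(cdim c)) (U : set M').
Variable phi : 'rV[R]_(cdim c) -> 'rV[R]_(cdim d).

(* The product chart c x d followed by (p, q) |-> (p, q - phi p), which maps
   the graph of phi to a coordinate plane. *)
Definition shear_chart : chart R (M * M')%type :=
  @Chart R (M * M')%type (cdim c + cdim d)
    ([set a | cdom c a /\ N (cmap c a)] `*` [set b | cdom d b /\ U b])
    [set r | N (lsubmx r) /\
       [set q | @crng _ _ d q /\ U (cinv q)] (rsubmx r + phi (lsubmx r))]
    (fun x => row_mx (cmap c x.1) (cmap d x.2 - phi (cmap c x.1)))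
    (fun r => (@cinv _ _ c (lsubmx r), @cinv _ _ d (rsubmx r + phi (lsubmx r)))).

Hypotheses (mM : is_manifold M) (mM' : is_manifold M').
Hypotheses (ac : atlas c) (ad : atlas d) (oN : open N) (oU : open U).
Hypotheses (Nc : N `<=` @crng _ _ c) (Cphi : Cinf N phi).

Let hc : is_chart c := manifold_chart mM ac.
Let hd : is_chart d := manifold_chart mM' ad.

Let T1 : set 'rV[R]_(cdim c + cdim d) := [set r | N (lsubmx r)].

Let Cl : Cinf setT (fun r : 'rV[R]_(cdim c + cdim d) => lsubmx r).
Proof. exact: Cinf_lsubmx openT (@Cinf_id _ _ _). Qed.

Let oT1 : open T1.
Proof.
rewrite (_ : T1 = (fun r : 'rV[R]_(cdim c + cdim d) => lsubmx r) @^-1` N) //.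
by apply: open_comp => // x _; exact: (Cinf_continuous Cl).
Qed.

Let Cl1 : Cinf T1 (fun r : 'rV[R]_(cdim c + cdim d) => lsubmx r).
Proof. by move=> k; apply: Ck_sub (Cl k). Qed.

Let psi (r : 'rV[R]_(cdim c + cdim d)) := rsubmx r + phi (lsubmx r).

Let Cpsi : Cinf T1 psi.
Proof.
apply: CinfD => //; first exact: Cinf_rsubmx oT1 (@Cinf_id _ _ _).
by move=> k; apply: (Ck_comp_row oT1 oN _ (Cl1 k) (Cphi k)).
Qed.

Lemma shear_chart_is_chart : is_chart shear_chart.
Proof.
have [oc rc dcr rcd [cc ci]] := hc; have [od rd ddr rdd [cd di]] := hd.
have cphi p : N p -> {for p, continuous phi} by move=> Np; exact: (Cinf_continuous Cphi).
split.
- apply: open_setX; first exact: open_preimage_in.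
  exact: openI.
- apply: (open_preimage_in oT1); first by move=> x Tx; exact: (Cinf_continuous Cpsi).
  by apply: open_preimage_in => // q rq; exact: di.
- move=> [a b] [/= [ca Na] [db Ub]]; rewrite row_mxKl row_mxKr subrK.
  have [ra ->] := dcr _ ca; have [rb eb] := ddr _ db; rewrite eb.
  by split.
- move=> r /= [Nr [rr Ur]]; have [ra ea] := rcd _ (Nc Nr).
  have [rb eb] := rdd _ rr.
  split; first by split=> /=; rewrite ?ea.
  by rewrite ea eb addrK hsubmxK.
- split=> [[a b] [/= [ca Na] [db Ub]]|r [/= Nr [rr Ur]]].
    have c1 : {for (a, b), continuous (fun x : M * M' => cmap c x.1)}.
      by apply: (@continuous_comp _ _ _ fst (cmap c)); [exact: cvg_fst|exact: cc].
    apply: cvg_row_mx; first exact: c1.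
    apply: cvgB.
      by apply: (@continuous_comp _ _ _ snd (cmap d)); [exact: cvg_snd|exact: cd].
    by apply: (@continuous_comp _ _ _ (fun x : M * M' => cmap c x.1) phi) => //; exact: cphi.
  apply: continuous_pair_for.
    apply: (@continuous_comp _ _ _ (fun r => lsubmx r) (@cinv _ _ c)).
      exact: (Cinf_continuous Cl).
    by apply: ci; exact: Nc.
  apply: (@continuous_comp _ _ _ psi (@cinv _ _ d)); last exact: di.
  exact: (Cinf_continuous Cpsi).
Qed.

Lemma shear_chart_atlas : @atlas R (prod_space M M') shear_chart.
Proof.
split; first exact: shear_chart_is_chart.
have [oc rc dcr rcd [cc ci]] := hc; have [od rd ddr rdd [cd di]] := hd.
move=> c' d' ac' ad'; split; apply: Cinf_local => r.
  move=> [/= [Nr [rr Ur]] [c'r d'r]].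
  have Sa : smooth_at (fun r => @cinv _ _ c (lsubmx r)) r.
    apply: (smooth_at_reparam openT I Cl).
    exact: smooth_at_cinv (manifold_charted mM) ac (Nc Nr).
  have Sb : smooth_at (fun r => @cinv _ _ d (psi r)) r.
    apply: (smooth_at_reparam oT1 Nr Cpsi).
    exact: smooth_at_cinv (manifold_charted mM') ad rr.
  have [N1 [oN1 N1r _ CN1]] := smooth_atE mM ac' Sa c'r.
  have [N2 [oN2 N2r _ CN2]] := smooth_atE mM' ad' Sb d'r.
  have oI : open (N1 `&` N2) by exact: openI.
  exists (N1 `&` N2); split=> //; apply: Cinf_row_mx => // k.
    by apply: Ck_sub (CN1 k) => ? [].
  by apply: Ck_sub (CN2 k) => ? [].
move=> [/= [r1 r2] [/= [cr Nr] [dr Ur]]].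
have Cl' : Cinf setT (fun r : 'rV[R]_(cdim c' + cdim d') => lsubmx r).
  exact: Cinf_lsubmx openT (@Cinf_id _ _ _).
have Cr' : Cinf setT (fun r : 'rV[R]_(cdim c' + cdim d') => rsubmx r).
  exact: Cinf_rsubmx openT (@Cinf_id _ _ _).
have Sa : smooth_at (fun r => @cinv _ _ c' (lsubmx r)) r.
  apply: (smooth_at_reparam openT I Cl').
  exact: smooth_at_cinv (manifold_charted mM) ac' r1.
have Sb : smooth_at (fun r => @cinv _ _ d' (rsubmx r)) r.
  apply: (smooth_at_reparam openT I Cr').
  exact: smooth_at_cinv (manifold_charted mM') ad' r2.
have [N1 [oN1 N1r _ CN1]] := smooth_atE mM ac Sa cr.
have [N2 [oN2 N2r _ CN2]] := smooth_atE mM' ad Sb dr.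
(* Shrinking keeps the first component inside [N], where [phi] is smooth. *)
pose N3 := [set r | (N1 `&` N2) r /\ N (cmap c (@cinv _ _ c' (lsubmx r)))].
have oN3 : open N3.
  apply: (open_preimage_in (openI oN1 oN2)) => // x [N1x _].
  exact: (Cinf_continuous CN1).
have CN1' : Cinf N3 (fun r => cmap c (@cinv _ _ c' (lsubmx r))).
  by move=> k; apply: Ck_sub (CN1 k) => ? [[]].
exists N3; split=> //; apply: Cinf_row_mx => //; apply: CinfB => // k.
  by apply: Ck_sub (CN2 k) => ? [[]].
by apply: (Ck_comp_row oN3 oN _ (CN1' k) (Cphi k)) => ? [].
Qed.

End Shear.

(** With [s] a local inverse of [g], the fibre product is locally the graph of [s \o f]. Shearing
    that graph flat gives a slice chart whose coordinates are those of the first component. *)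
Lemma smooth_at_fibre_product (V : normedModType R) (M M' B : smooth_space R)
    (f : M -> B) (g : M' -> B)
    (k : V -> @sub_space R (prod_space M M') [set p | f p.1 = g p.2]) (x : V) :
  is_manifold M -> is_manifold M' -> is_manifold B -> smooth f -> local_diffeo g ->
  smooth_at (M := M) (fun y => (set_val (k y)).1) x ->
  smooth_at (M := M') (fun y => (set_val (k y)).2) x ->
  smooth_at k x.
Proof.
move=> mM mM' mB sf ldg Sa Sb.
pose a y : M := (set_val (k y)).1; pose b y : M' := (set_val (k y)).2.
have ab y : f (a y) = g (b y) by exact: (set_mem (valP (k y))).
have [U [W [s [oU Ub oW [gU sW] [_ ss]]]]] := ldg (b x).
have [_ _ cov _ _] := mM; have [_ _ cov' _ _] := mM'.
have [c ac cx] := cov (a x); have [d ad dx] := cov' (b x).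
have [oc rc dcr rcd [cc ci]] := manifold_chart mM ac.
have [od rd ddr rdd [cd di]] := manifold_chart mM' ad.
have [rx ex] := dcr _ cx.
have Sf : smooth_at (fun p => f (@cinv _ _ c p)) (cmap c (a x)).
  apply: (smooth_at_comp (manifold_charted mM) sf I).
  exact: smooth_at_cinv (manifold_charted mM) ac rx.
have Wfx : W (f (a x)) by rewrite ab; exact: (gU _ Ub).1.
have Ssf : smooth_at (fun p => s (f (@cinv _ _ c p))) (cmap c (a x)).
  apply: (smooth_at_comp (manifold_charted mB) ss) => //.
  by rewrite ex.
have esx : s (f (@cinv _ _ c (cmap c (a x)))) = b x by rewrite ex ab (gU _ Ub).2.
have dsx : cdom d (s (f (@cinv _ _ c (cmap c (a x))))) by rewrite esx.
have [N0 [oN0 N0x N0d CN0]] := smooth_atE mM' ad Ssf dsx.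
have cf : {for cmap c (a x), continuous (fun p => f (@cinv _ _ c p))}.
  apply: smooth_at_continuous Sf => e; exact: manifold_chart.
have : nbhs (cmap c (a x)) (N0 `&` @crng _ _ c `&` [set p | W (f (@cinv _ _ c p))]).
  apply: filterI; first by apply: open_nbhs_nbhs; split=> //; exact: openI.
  by apply: cf; apply: open_nbhs_nbhs; split=> //=; rewrite ex.
rewrite nbhsE => -[N [oN Nx] NP].
pose phi p := cmap d (s (f (@cinv _ _ c p))).
have Cphi : Cinf N phi by move=> n; apply: Ck_sub (CN0 n) => p /NP[[]].
have Nc : N `<=` @crng _ _ c by move=> p /NP[[]].
pose C := shear_chart N U phi.
have hC : is_chart C := shear_chart_is_chart mM mM' ac ad oN oU Nc Cphi.
have aC : @atlas _ (prod_space M M') C := shear_chart_atlas mM mM' ac ad oN oU Nc Cphi.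
pose D := @slice_chart (prod_space M M') _ C (cdim c) (k x).
have slC : @slice_of _ (prod_space M M') _ C D.
  apply: slice_chartP => //; first exact: leq_addr.
  move=> [p q] /= [[/= cp Np] [dq Uq]].
  have [rp ep] := dcr _ cp; have [_ Wp] := NP _ Np; rewrite /= ep in Wp.
  have [[N0p _] _] := NP _ Np.
  have phip : phi (cmap c p) = cmap d (s (f p)) by rewrite /phi ep.
  (* On the domain [q] lies in [U], so [f p = g q] forces [q = s (f p)]. Conversely, vanishing tail
     coordinates give [q = s (f p)] by injectivity of [cmap d]. *)
  split=> [fg i ci'|vanish].
    rewrite phip fg (gU _ Uq).2 subrr.
    by rewrite -pad_row_mx0 mxE insubN// -leqNgt.
  have {vanish} : cmap d q - phi (cmap c p) = 0.
    apply/rowP => i; have := vanish (rshift _ i) (leq_addr _ _).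
    by rewrite row_mxEr => ->; rewrite mxE.
  move=> /eqP; rewrite subr_eq0 => /eqP; rewrite phip => eq.
  have ds : cdom d (s (f p)) by have := N0d _ N0p; rewrite ep.
  have := (ddr _ dq).2; rewrite eq (ddr _ ds).2 => <-.
  by rewrite (sW _ Wp).2.
have [N1 [oN1 N1x N1c CN1]] := smooth_atE mM ac Sa cx.
have [N2 [oN2 N2x N2d CN2]] := smooth_atE mM' ad Sb dx.
have cb : {for x, continuous b}.
  apply: smooth_at_continuous Sb => e; exact: manifold_chart.
have : nbhs x (N1 `&` N2 `&` [set y | N (cmap c (a y))] `&` [set y | U (b y)]).
  apply: filterI; last by apply: cb; exact: open_nbhs_nbhs.
  apply: filterI; first by apply: open_nbhs_nbhs; split=> //; exact: openI.
  by apply: (Cinf_continuous CN1 N1x); exact: open_nbhs_nbhs.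
rewrite nbhsE => -[N3 [oN3 N3x] N3P].
have N3C y : N3 y -> cdom C (set_val (k y)).
  by move=> /N3P[[[N1y N2y] Ny] Uy]; split; split=> //; [exact: N1c|exact: N2d].
exists D; split.
- by exists C.
- exact: N3C.
- exists N3; split=> // n.
  have C1 : Ck n N3 (fun y => cmap c (a y)) by apply: Ck_sub (CN1 n) => y /N3P[[[]]].
  by apply: (Ck_eq oN3 _ C1) => y N3y /=; rewrite pad_row_mx.
Qed.

End FibreProducts.

(** * The inverse function theorem *)

(** Combines completeness of row vectors with their norm, as [banach_fixed_point] requires. *)
HB.instance Definition _ (R : realType) n := Complete.on (matrix R 1 n).

Section InverseFunction.
Local Set Implicit Arguments.
Local Unset Strict Implicit.
Local Open Scope classical_set_scope.
Local Open Scope ring_scope.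
Variable R : realType.

Lemma near_bounded_cvg0 (V W : normedModType R) (f : V -> W) :
  (\forall h \near (0 : V), `|f h| <= 2 * `|h|) -> f h @[h --> (0 : V)] --> (0 : W).
Proof.
move=> fle; apply/cvgrPdist_le => d d0; have d20 : 0 < d / 2 by rewrite divr_gt0.
near=> h; rewrite sub0r normrN.
have : `|f h| <= 2 * `|h| by near: h.
have : `|h| <= d / 2 by near: h; exact: nbhs0_le.
lra.
Unshelve. all: by end_near. Qed.

(** * Smooth dependence of determinants and inverse matrices *)

Lemma Ck_prod (V : normedModType R) k (U : set V) I (s : seq I) (P : pred I)
    (f : I -> V -> R^o) :
  open U -> (forall i, Ck k U (f i)) ->
  Ck k U (fun x => \prod_(i <- s | P i) f i x : R^o).
Proof.
move=> oU Cf; elim: s => [|i s IHs].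
  by apply: (Ck_eq oU _ (@Ck_cst _ V R^o k U 1)) => x _; rewrite big_nil.
case Pi: (P i).
  by apply: (Ck_eq oU _ (CkM oU (Cf i) IHs)) => x _; rewrite big_cons Pi.
by apply: (Ck_eq oU _ IHs) => x _; rewrite big_cons Pi.
Qed.

Lemma Ck_det (V : normedModType R) k (U : set V) n (J : V -> 'M[R]_n) :
  open U -> (forall i j, Ck k U (fun x => J x i j : R^o)) ->
  Ck k U (fun x => \det (J x) : R^o).
Proof.
move=> oU CJ; apply: Ck_sum => // s; apply: CkM => //; first exact: Ck_cst.
by apply: Ck_prod.
Qed.

Lemma Ck_invmx (V : normedModType R) k (U : set V) n (J : V -> 'M[R]_n) i j :
  open U -> (forall x, U x -> J x \in unitmx) ->
  (forall i j, Ck k U (fun x => J x i j : R^o)) ->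
  Ck k U (fun x => invmx (J x) i j : R^o).
Proof.
move=> oU uJ CJ.
have Cdet : Ck k U (fun x => (\det (J x))^-1 : R^o).
  apply: CkV => //; last exact: Ck_det.
  by move=> x /uJ; rewrite unitmxE unitfE.
have Cadj : Ck k U (fun x => (\adj (J x)) i j : R^o).
  have C1 : Ck k U (fun x => \det (row' j (col' i (J x))) : R^o).
    apply: Ck_det => // i' j'.
    by apply: (Ck_eq oU _ (CJ (lift j i') (lift i j'))) => x _; rewrite !mxE.
  apply: (Ck_eq oU _ (CkM oU (@Ck_cst _ V R^o k U ((-1) ^+ (j + i))) C1)) => x _.
  by rewrite mxE.
apply: (Ck_eq oU _ (CkM oU Cdet Cadj)) => x Ux.
by rewrite /invmx uJ// [RHS]mxE.
Qed.

Lemma Cinf_mulmx n m (A : 'M[R]_(n, m)) (V : normedModType R) (U : set V)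
    (f : V -> 'rV[R]_n) :
  open U -> Cinf U f -> Cinf U (fun x => f x *m A).
Proof.
move=> oU Cf k; apply: Ck_rowP => // i.
apply: (@Ck_eq _ _ _ _ _ (fun x => \sum_j (f x 0 j * A j i : R^o))) => //.
  by move=> x _; rewrite mxE.
apply: Ck_sum => // j; apply: CkM => //; last exact: Ck_cst.
by have := Ck_coord j oU (Cf k).
Qed.

Lemma mulmxr_continuous n m (A : 'M[R]_(n, m)) :
  continuous (fun v : 'rV[R]_n => v *m A).
Proof.
move=> p; have := Cinf_mulmx A openT (@Cinf_id R 'rV[R]_n setT).
by move=> /Cinf_continuous; exact.
Qed.

Lemma coord_le_norm n (v : 'rV[R]_n) i : `|v 0 i| <= `|v|.
Proof.
rewrite [leRHS]/Num.norm /= mx_normrE.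
exact: (le_bigmax _ (fun ij => `|v ij.1 ij.2|) (0, i)).
Qed.

Lemma norm_le_coord n (v : 'rV[R]_n) e : 0 <= e ->
  (forall i, `|v 0 i| <= e) -> `|v| <= e.
Proof.
move=> e0 ve; rewrite [leLHS]/Num.norm /= mx_normrE; apply: bigmax_le => //.
by move=> [i j] _; rewrite ord1; exact: ve.
Qed.

(* Row i holds the derivative along the i-th basis vector, so that the
   differential is right multiplication of row vectors. *)
Definition jac n m (f : 'rV[R]_n -> 'rV[R]_m) (x : 'rV[R]_n) : 'M[R]_(n, m) :=
  \matrix_(i, j) 'D_(delta_mx 0 i) f x 0 j.

Lemma derive_jac n m (f : 'rV[R]_n -> 'rV[R]_m) x v :
  differentiable f x -> 'D_v f x = v *m jac f x.
Proof.
move=> df; rewrite deriveE// {1}(row_sum_delta v) linear_sum; apply/rowP => j.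
rewrite summxE mxE; apply: eq_bigr => i _.
by rewrite linearZ mxE -deriveE// [in RHS]mxE.
Qed.

Lemma Ck_jac n m k (U : set 'rV[R]_n) (f : 'rV[R]_n -> 'rV[R]_m) i j :
  open U -> Ck k.+1 U f -> Ck k U (fun x => jac f x i j : R^o).
Proof.
move=> oU [_ Cf]; apply: (Ck_eq oU _ (Ck_coord j oU (Cf (delta_mx 0 i)))) => x _.
by rewrite mxE.
Qed.

(* The mean value inequality, applied to f - id coordinatewise. *)
Lemma near_identity_lipschitz n (U : set 'rV[R]_n) (f : 'rV[R]_n -> 'rV[R]_n)
    (p : 'rV[R]_n) (r : R) :
  0 < r -> (forall x : 'rV[R]_n, `|x - p| <= r -> U x) -> (forall x, U x -> differentiable f x) ->
  (forall x : 'rV[R]_n, `|x - p| <= r -> forall i j : 'I_n,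
     `|(jac f x - 1%:M) i j| <= (2 * n.+1%:R)^-1) ->
  (forall x (v : 'rV[R]_n), `|x - p| <= r -> `|v *m jac f x - v| <= 2^-1 * `|v|) /\
  (forall x y : 'rV[R]_n, `|x - p| <= r -> `|y - p| <= r ->
     `|(f x - x) - (f y - y)| <= 2^-1 * `|x - y|).
Proof.
move=> r0 rU df jacle.
have bnd x (v : 'rV[R]_n) i : `|x - p| <= r -> `|(v *m (jac f x - 1%:M)) 0 i| <= 2^-1 * `|v|.
  move=> xr; rewrite mxE; apply: le_trans (ler_norm_sum _ _ _) _.
  (* The norm is the maximum of the coordinates: [n] terms, each at most [|v| / (2 (n + 1))], add up
     to at most [|v| / 2]. Using [n + 1] keeps the constant positive when [n = 0]. *)
  apply: (@le_trans _ _ (\sum_(j < n) `|v| * (2 * n.+1%:R)^-1)).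
    apply: ler_sum => j _; rewrite normrM; apply: ler_pM => //.
      exact: coord_le_norm.
    exact: jacle.
  rewrite sumr_const card_ord -[leLHS]mulr_natr -mulrA mulrC ler_wpM2r//.
  rewrite invfM -mulrA -[leRHS]mulr1 ler_wpM2l ?invr_ge0//.
  by rewrite mulrC ler_pdivrMr// mul1r ler_nat.
split.
  move=> x v xr; apply: norm_le_coord => [|i]; first by rewrite mulr_ge0 ?invr_ge0.
  have -> : v *m jac f x - v = v *m (jac f x - 1%:M) by rewrite mulmxBr mulmx1.
  exact: bnd.
move=> x y xr yr; apply: norm_le_coord => [|i]; first by rewrite mulr_ge0 ?invr_ge0.
(* The segment from [y] to [x], which stays in the closed ball by convexity. *)
pose l (t : R^o) : 'rV[R]_n := y + t *: (x - y).
have lr t : 0 <= t <= 1 -> `|l t - p| <= r.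
  move=> /andP[t0 t1]; have -> : l t - p = (1 - t) *: (y - p) + t *: (x - p).
    rewrite /l scalerBl scale1r !scalerBr; apply/rowP => j; rewrite !mxE; ring.
  apply: le_trans (ler_normD _ _) _; rewrite !normrZ !ger0_norm// ?subr_ge0//.
  apply: (@le_trans _ _ ((1 - t) * r + t * r)).
    by apply: lerD; apply: ler_wpM2l; rewrite ?subr_ge0.
  by rewrite -mulrDl subrK mul1r.
pose F (z : 'rV[R]_n) : R^o := (f z - z) 0 i.
pose h (t : R) : R := F (l t).
have dl t : is_diff (t : R^o) l (fun s => s *: (x - y)).
  have := @is_diffD R R^o 'rV[R]_n (cst y) ( *:%R^~ (x - y)) 0 ( *:%R^~ (x - y)) t
    (is_diff_cst _ _) (is_diff_scalel _ _).
  by rewrite add0r.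
have dF z : U z -> differentiable F z.
  move=> Uz; apply: (@differentiable_comp _ _ _ _ (fun z => f z - z) (fun w : 'rV[R]_n => w 0 i : R^o)).
    by apply: differentiableB; [exact: df|have [] := is_diff_id z].
  exact: differentiable_coord.
have DF z (v : 'rV[R]_n) : U z -> 'D_v F z = (v *m (jac f z - 1%:M)) 0 i.
  move=> Uz; have dfz := @diff_derivable _ _ _ f z v (df z Uz).
  have D := @is_deriveB R _ _ f id z v _ v (derivableP dfz) (is_derive_id z v).
  have := congr1 (fun w : 'rV[R]_n => w 0 i) (derive_mx (@ex_derive _ _ _ _ _ _ _ D)).
  rewrite mxE (@derive_val _ _ _ _ _ _ _ D) derive_jac; last exact: df.
  by move=> E; rewrite mulmxBr mulmx1 E.
have dh t : 0 <= t <= 1 -> is_derive (t : R^o) 1 h (((x - y) *m (jac f (l t) - 1%:M)) 0 i).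
  move=> /lr/rU Ult; have dlt : differentiable l t by have [] := dl t.
  have d1 : differentiable (F \o l) (t : R^o) by apply: differentiable_comp => //; exact: dF.
  apply: DeriveDef; first exact: diff_derivable.
  rewrite deriveE// diff_comp//; last exact: dF.
  rewrite /= -deriveE; last exact: dF.
  have -> : 'd l t 1 = x - y by rewrite diff_val scale1r.
  exact: DF.
have [||c] := @MVT R h (fun t => ((x - y) *m (jac f (l t) - 1%:M)) 0 i) 0 1 ltr01.
- by move=> t; rewrite in_itv/= => /andP[t0 t1]; apply: dh; rewrite !ltW.
- apply: derivable_within_continuous => t; rewrite in_itv/= => t01.
  by have [] := dh t t01.
rewrite in_itv/= => /andP[c0 c1]; rewrite subr0 mulr1 => E.
have -> : (f x - x - (f y - y)) 0 i = h 1 - h 0.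
  by rewrite /h /F /l scale1r scale0r addr0 [y + _]addrC subrK !mxE.
by rewrite E; apply: bnd; apply: lr; rewrite !ltW.
Qed.

Lemma jac_near_id n (U : set 'rV[R]_n) (f : 'rV[R]_n -> 'rV[R]_n) (p : 'rV[R]_n)
    (e : R) :
  open U -> U p -> Cinf U f -> jac f p = 1%:M -> 0 < e ->
  exists2 r : R, 0 < r & forall x : 'rV[R]_n, `|x - p| <= r ->
    U x /\ forall i j : 'I_n, `|(jac f x - 1%:M) i j| <= e.
Proof.
move=> oU Up Cf J e0.
have Jc i j : \forall x \near p, `|(jac f x - 1%:M) i j| <= e.
  have := Cinf_continuous (fun k => Ck_jac i j oU (Cf k.+1)) Up.
  move=> /(@cvgrPdist_le R R^o) /(_ e e0); apply: filterS => x.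
  by rewrite J distrC; rewrite !mxE.
have : \forall x \near p, U x /\ forall i j, `|(jac f x - 1%:M) i j| <= e.
  apply: filterI; first exact: open_nbhs_nbhs.
  have Jc' i : \forall x \near p, forall j : 'I_n, `|(jac f x - 1%:M) i j| <= e.
    exact: (@filter_forall _ _ (fun j => [set x | `|(jac f x - 1%:M) i j| <= e]) (nbhs p) _ (Jc i)).
  exact: (@filter_forall _ _ (fun i => [set x | forall j, `|(jac f x - 1%:M) i j| <= e]) (nbhs p) _ Jc').
move=> /nbhs_closedballP[r rP]; exists r%:num => // x xr.
by apply: rP; rewrite closed_ballE// /closed_ball_ /= distrC.
Qed.

(** A preimage of [y] is a fixed point of [x |-> y - (f x - x)], which contracts with ratio 1/2 near
    [p] because the Jacobian there is close to 1. *)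
Theorem inverse_function n (U : set 'rV[R]_n) (f : 'rV[R]_n -> 'rV[R]_n)
    (p : 'rV[R]_n) :
  open U -> U p -> Cinf U f -> jac f p = 1%:M ->
  exists (N W : set 'rV[R]_n) (g : 'rV[R]_n -> 'rV[R]_n),
  [/\ open N /\ N p, N `<=` U, open W,
      (forall x, N x -> W (f x) /\ g (f x) = x) /\
      (forall y, W y -> N (g y) /\ f (g y) = y) & Cinf W g].
Proof.
move=> oU Up Cf J.
have e0 : 0 < (2 * n.+1%:R)^-1 :> R by rewrite invr_gt0 mulr_gt0.
have [r r0 rP] := jac_near_id oU Up Cf J e0.
have df x : U x -> differentiable f x := Cinf_differentiable Cf.
have [jinj lip] := near_identity_lipschitz r0 (fun x xr => (rP x xr).1) df
  (fun x xr => (rP x xr).2).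
have r20 : 0 < r / 2 by rewrite divr_gt0.
(* As [f - id] is 1/2-Lipschitz, [f] shrinks distances by a factor 2 at most. This yields
   injectivity and the Lipschitz constant 2 of the inverse. *)
have expand x y : `|x - p| <= r -> `|y - p| <= r -> `|x - y| <= 2 * `|f x - f y|.
  move=> xr yr; have := lip _ _ xr yr.
  have -> : x - y = (f x - f y) - ((f x - x) - (f y - y)).
    by apply/rowP => i; rewrite !mxE; ring.
  set a := f x - f y; set b := _ - (f y - y) => bab.
  have := ler_normB a b; lra.
(* Half the radius goes to [y - f p] and half to the contraction, so the closed ball is mapped into
   itself. By [expand], the strict bound puts the fixed point in the open ball. *)
pose W : set 'rV[R]_n := [set y | `|y - f p| < r / 2].
pose B : set 'rV[R]_n := [set x | `|x - p| <= r].
have ontoP y : W y -> exists2 x, `|x - p| < r & f x = y.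
  move=> Wy.
  have phiB : {homo (fun x => y - (f x - x)) : x / B x >-> B x}.
    move=> x Bx; rewrite /B /=.
    have -> : y - (f x - x) - p = (y - f p) - ((f x - x) - (f p - p)).
      by apply/rowP => i; rewrite !mxE; ring.
    have := lip x p Bx; rewrite subrr normr0 => /(_ (ltW r0)).
    move: Bx Wy; rewrite /B /W /= => Bx Wy.
    have := ler_normB (y - f p) ((f x - x) - (f p - p)); lra.
  pose phi : {fun B >-> B} := mkfun_fun phiB.
  have cphi : is_contraction phi.
    exists (2^-1)%:nng; split; first by rewrite /= invf_lt1// ltr1n.
    move=> [x x'] [/= Bx Bx'].
    have -> : y - (f x - x) - (y - (f x' - x')) = - ((f x - x) - (f x' - x')).
      by apply/rowP => i; rewrite !mxE; ring.
    by rewrite normrN; exact: lip.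
  have cB : closed B.
    have -> : B = closed_ball p r.
      by rewrite closed_ballE//; apply/seteqP; split=> x; rewrite /B /closed_ball_ /= distrC.
    exact: closed_ball_closed.
  have [|x Bx xE] := banach_fixed_point cphi cB.
    by exists p; rewrite /B /= subrr normr0 ltW.
  have fxy : f x = y.
    by move: xE; rewrite /= /mkfun => /eqP; rewrite opprB addrCA -subr_eq0 opprD addrA subrr add0r opprB subr_eq0 => /eqP.
  exists x => //.
  have := expand x p Bx; rewrite subrr normr0 fxy => /(_ (ltW r0)).
  by move: Wy; rewrite /W /=; lra.
pose g y := if pselect (W y) is left Wy then sval (cid2 (ontoP y Wy)) else p.
have gP y : W y -> `|g y - p| < r /\ f (g y) = y.
  by move=> Wy; rewrite /g; case: pselect => // W'y; case: cid2.
pose N : set 'rV[R]_n := [set x | `|x - p| < r /\ W (f x)].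
have oball (q : 'rV[R]_n) (s : R) : open [set x | `|x - q| < s].
  have -> : [set x | `|x - q| < s] = ball q s.
    by rewrite -ball_normE; apply/seteqP; split=> x; rewrite /= distrC.
  exact: ball_open.
have oW : open W by exact: oball.
have oN : open N.
  rewrite openE => x [xr Wx].
  have Ux : U x by apply: (rP _ (ltW xr)).1.
  apply: filterI; first exact: open_nbhs_nbhs (conj (oball p r) xr).
  by apply: (Cinf_continuous Cf Ux); exact: open_nbhs_nbhs.
have gdist y y' : W y -> W y' -> `|g y - g y'| <= 2 * `|y - y'|.
  move=> /gP[gy fgy] /gP[gy' fgy'].
  by have := expand _ _ (ltW gy) (ltW gy'); rewrite fgy fgy'.
(* A vector [v] in the kernel satisfies [|v| <= |v| / 2]. *)
have Ju x : `|x - p| <= r -> jac f x \in unitmx.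
  move=> xr; rewrite -row_free_unit -kermx_eq0; apply/rowV0P => v.
  rewrite sub_kermx => /eqP vJ; have := jinj x v xr; rewrite vJ sub0r normrN => le.
  apply/eqP; rewrite -normr_eq0; have := normr_ge0 v; lra.
have dg y : W y -> differentiable g y /\
    'd g y = (fun v => v *m invmx (jac f (g y))) :> ('rV[R]_n -> 'rV[R]_n).
  move=> Wy; have [gyr fgy] := gP y Wy; have uJ := Ju _ (ltW gyr).
  pose L : {linear 'rV[R]_n -> 'rV[R]_n} := mulmxr (invmx (jac f (g y))).
  have cL : continuous L by exact: mulmxr_continuous.
  have [C C0 LC] := linear_lipschitz cL.
  have gE : g \o shift y = cst (g y) + L +o_ 0 id.
    apply/eqaddoP => e e_gt0.
    (* Put [k = g (h + y) - g y]. The error of [g] at [h] is [- L] of the error of [f] at [k]; the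
       factor [C] pays for [L], and 2 for [|k| <= 2 |h|]. *)
    have e'0 : 0 < e / (2 * C) by rewrite divr_gt0// mulr_gt0.
    have dfy := df _ (rP _ (ltW gyr)).1.
    have := diff_locally dfy => /eqaddoP /(_ _ e'0) fo.
    have Wnear : \forall h \near (0 : 'rV[R]_n), W (h + y).
      have : (h + y) @[h --> (0 : 'rV[R]_n)] --> y.
        exact: cvg_shift0.
      by move=> /(_ W); apply; apply: open_nbhs_nbhs.
    have k0 : g (h + y) - g y @[h --> (0 : 'rV[R]_n)] --> (0 : 'rV[R]_n).
      apply: near_bounded_cvg0; apply: filterS Wnear => h Wh.
      by have := gdist _ _ Wh Wy; rewrite addrK.
    have fo' := k0 _ fo.
    near=> h.
    have Wh : W (h + y) by near: h.
    have : `|(f \o shift (g y) - (cst (f (g y)) + 'd f (g y))) (g (h + y) - g y)|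
        <= e / (2 * C) * `|g (h + y) - g y| by near: h.
    set k := g (h + y) - g y.
    have -> : (f \o shift (g y) - (cst (f (g y)) + 'd f (g y))) k = h - k *m jac f (g y).
      rewrite -(derive_jac _ dfy) deriveE// /GRing.add/GRing.opp/=.
      by rewrite subrK (gP _ Wh).2 fgy opprD addrA addrK.
    have -> : (g \o shift y - (cst (g y) + L)) h = - L (h - k *m jac f (g y)).
      rewrite linearB/= mulmxK// opprB.
      by rewrite /GRing.add/GRing.opp/= opprD addrA.
    move=> le1; rewrite normrN (le_trans (LC _))//.
    apply: (@le_trans _ _ (C * (e / (2 * C) * (2 * `|h|)))).
      rewrite ler_wpM2l ?(ltW C0)// (le_trans le1)// ler_wpM2l ?(ltW e'0)//.
      by have := gdist _ _ Wh Wy; rewrite addrK.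
    rewrite le_eqVlt; apply/orP; left; apply/eqP; field.
    by rewrite gt_eqF.
  have dE : 'd g y = L :> (_ -> _) by exact: diff_unique.
  split; last exact: dE.
  by apply/diff_locallyP; rewrite dE.
exists N, W, g; split.
- by split=> //; split=> /=; rewrite /W /= subrr normr0.
- by move=> x [xr _]; apply: (rP _ (ltW xr)).1.
- by [].
- split=> [x [xr Wx]|y Wy]; last first.
    by have [gr fg] := gP _ Wy; split=> //; split=> //; rewrite fg.
  split=> //; have [gr fg] := gP _ Wx.
  apply/eqP; rewrite -subr_eq0 -normr_le0.
  by have := expand _ _ (ltW gr) (ltW xr); rewrite fg subrr normr0 mulr0.
(* Bootstrapping: the derivative of [g] is the inverse Jacobian of [f] evaluated at [g], hence as
   regular as [g] itself, which gains one order. *)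
- elim=> [|k IHk]; first by move=> y /dg[/differentiable_continuous].
  split=> [y /dg[]//|v].
  have gN y : W y -> N (g y).
    by move=> Wy; have [gr fg] := gP _ Wy; split=> //; rewrite fg.
  have Cinv i j : Ck k W (fun y => invmx (jac f (g y)) i j : R^o).
    apply: (@Ck_comp _ _ _ _ W N g (fun x => invmx (jac f x) i j : R^o)) => //.
    apply: Ck_invmx => // [x [xr _]|i' j']; first exact/Ju/ltW.
    apply: Ck_jac => //; apply: Ck_sub (Cf k.+1) => x [xr _].
    exact: (rP _ (ltW xr)).1.
  apply: Ck_rowP => // i.
  apply: (@Ck_eq _ _ _ _ _ (fun y => \sum_j (v 0 j * invmx (jac f (g y)) j i : R^o))) => //.
    move=> y Wy; have [dgy dE] := dg y Wy.
    by rewrite deriveE// dE mxE.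
  apply: Ck_sum => // j; apply: CkM => //; exact: Ck_cst.
Unshelve. all: by end_near. Qed.

End InverseFunction.

(** * Smooth neighbourhood retracts *)

Section NeighbourhoodRetracts.
Local Set Implicit Arguments.
Local Unset Strict Implicit.
Local Open Scope classical_set_scope.
Local Open Scope ring_scope.
Variable R : realType.

(** A product chart is a shear along the zero map, so it inherits [shear_chart_is_chart]. *)
Lemma prod_chartE (M M' : smooth_space R) (c : chart R M) (d : chart R M') :
  is_chart c -> prod_chart c d = shear_chart (d := d) (@crng _ _ c) setT (fun=> 0).
Proof.
move=> [_ _ dr _ _]; rewrite /prod_chart /shear_chart; congr Chart.
- apply/seteqP; split=> -[a b] /=; last by case=> -[? _] [? _].
  by case=> ca db; split=> //; split=> //; have [] := dr _ ca.
- by apply/seteqP; split=> r /=; rewrite addr0 => -[? h]; split=> //; case: h.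
- by apply/funext => x; rewrite subr0.
- by apply/funext => r; rewrite addr0.
Qed.

Lemma prod_chart_is_chart (M M' : smooth_space R) (c : chart R M) (d : chart R M') :
  is_manifold M -> is_manifold M' -> atlas c -> atlas d -> is_chart (prod_chart c d).
Proof.
move=> mM mM' ac ad; have hc := manifold_chart mM ac.
rewrite prod_chartE//; have [_ oc _ _ _] := hc.
apply: shear_chart_is_chart => //; first exact: openT.
exact: Cinf_cst.
Qed.

Lemma smooth_at_prodE (V : normedModType R) (M M' : smooth_space R) (a : V -> M)
    (b : V -> M') (x : V) (C : chart R (M * M')%type) :
  is_manifold M -> is_manifold M' -> @atlas R (prod_space M M') C ->
  cdom C (a x, b x) -> smooth_at a x -> smooth_at b x ->
  exists N : set V, [/\ open N, N x, (forall y, N y -> cdom C (a y, b y)) &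
    Cinf N (fun y => cmap C (a y, b y))].
Proof.
move=> mM mM' [[oC _ _ _ _] cC] Cx [c [ac cx [N [oN Nx Nc CN]]]].
move=> [d [ad dx [N' [oN' N'x N'd CN']]]].
have hP := prod_chart_is_chart mM mM' ac ad.
have oI : open (N `&` N') by exact: openI.
have [||oT CT] := smooth_at_transition (g := fun y => (a y, b y)) hP oC (cC _ _ ac ad).2 oI.
- by move=> y [/Nc ? /N'd ?]; split.
- apply: Cinf_row_mx => // k; first by apply: Ck_sub (CN k) => y [].
  by apply: Ck_sub (CN' k) => y [].
- by exists [set y | (N `&` N') y /\ cdom C (a y, b y)]; split=> // y [].
Qed.

(** Reduces smoothness into [S] to smoothness into [M] plus a single slice chart at the point;
    finding that chart is the purpose of the rest of this section. *)
Lemma smooth_at_sub (V : normedModType R) (M : smooth_space R) (S : set M)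
    (k : V -> @sub_space R M S) (x : V) (d : chart R S) :
  is_manifold M -> @atlas R (@sub_space R M S) d -> cdom d (k x) ->
  smooth_at (M := M) (fun y => set_val (k y)) x -> smooth_at k x.
Proof.
move=> mM ad dx Sk; have [c ac [le Sc cd rc [md id]]] := ad.
have [N [oN Nx Nc CN]] := smooth_atE mM ac Sk ((cd _).1 dx).
exists d; split=> //; exists N; split=> //; first by move=> y /Nc /cd.
move=> n; have Cp := Cinf_pad (cdim d) oN CN; apply: (Ck_eq oN _ (Cp n)) => y Ny.
by rewrite md//; apply/cd; exact: Nc.
Qed.

Definition recoordinate (M : smooth_space R) (c : chart R M)
    (N W : set 'rV[R]_(cdim c)) (f g : 'rV[R]_(cdim c) -> 'rV[R]_(cdim c)) : chart R M :=
  @Chart R M (cdim c) [set x | cdom c x /\ N (cmap c x)] W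
    (fun x => f (cmap c x)) (fun q => @cinv _ _ c (g q)).

Section Recoordinate.
Variables (M : smooth_space R) (c : chart R M) (N W : set 'rV[R]_(cdim c)).
Variables f g : 'rV[R]_(cdim c) -> 'rV[R]_(cdim c).
Hypotheses (mM : is_manifold M) (ac : atlas c) (oN : open N) (oW : open W).
Hypotheses (Nc : N `<=` @crng _ _ c) (fN : forall p, N p -> W (f p) /\ g (f p) = p).
Hypotheses (gW : forall q, W q -> N (g q) /\ f (g q) = q).
Hypotheses (Cf : Cinf N f) (Cg : Cinf W g).

Lemma recoordinate_is_chart : is_chart (recoordinate N W f g).
Proof.
have [oc rc dcr rcd [cc ci]] := manifold_chart mM ac.
split=> /=.
- exact: open_preimage_in.
- exact: oW.
- move=> x [cx Nx]; have [Wx ->] := fN Nx; split=> //.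
  by have [] := dcr _ cx.
- move=> q Wq; have [Ng fg] := gW Wq; have [cg eg] := rcd _ (Nc Ng).
  by rewrite /= eg.
- split=> [x [cx Nx]|q Wq].
    apply: (@continuous_comp _ _ _ (cmap c) f); first exact: cc.
    exact: (Cinf_continuous Cf).
  apply: (@continuous_comp _ _ _ g (@cinv _ _ c)); first exact: (Cinf_continuous Cg).
  by apply: ci; apply: Nc; exact: (gW Wq).1.
Qed.

(** The atlas of a manifold is maximal, so compatibility with its charts is enough. *)
Lemma recoordinate_atlas : atlas (recoordinate N W f g).
Proof.
have [_ _ _ _ max] := mM; apply: max => [|d ad].
  exact: recoordinate_is_chart.
have [oc rc dcr rcd [cc ci]] := manifold_chart mM ac.
split; apply: Cinf_local => q.
  move=> [/= Wq dq].
  have Sg : smooth_at (fun q => @cinv _ _ c (g q)) q.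
    apply: (smooth_at_reparam oW Wq Cg).
    apply: smooth_at_cinv (manifold_charted mM) ac _.
    by apply: Nc; exact: (gW Wq).1.
  have [N1 [oN1 N1q _ CN1]] := smooth_atE mM ad Sg dq.
  by exists N1.
move=> [/= rq [cq Nq]].
have Sd := smooth_at_cinv (manifold_charted mM) ad rq.
have [N1 [oN1 N1q _ CN1]] := smooth_atE mM ac Sd cq.
pose N2 := [set q | N1 q /\ N (cmap c (@cinv _ _ d q))].
have oN2 : open N2.
  by apply: open_preimage_in => // x N1x; exact: (Cinf_continuous CN1).
exists N2; split=> // k.
apply: (Ck_comp_row oN2 oN _ _ (Cf k)); first by move=> ? [].
by apply: Ck_sub (CN1 k) => ? [].
Qed.

End Recoordinate.

Lemma mul_pid_tail n k (u : 'rV[R]_n) (j : 'I_n) :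
  (u *m (pid_mx k : 'M[R]_n)) 0 j = if (j < k)%N then u 0 j else 0.
Proof.
rewrite mxE (bigD1 j)//= big1 => [|i ij].
  by rewrite addr0 mxE eqxx /=; case: ifP => _; rewrite ?mulr1 ?mulr0.
by rewrite mxE (inj_eq val_inj) (negbTE ij) mulr0.
Qed.

(* An idempotent matrix projects onto its row space, which row_ebase P maps
   to a coordinate plane. *)
Lemma idempotent_coord n (P : 'M[R]_n) (y : 'rV[R]_n) : P *m P = P ->
  y *m (1%:M - P) = 0 <->
  forall i : 'I_n, (\rank P <= i)%N -> (y *m invmx (row_ebase P)) 0 i = 0.
Proof.
move=> PP; have uE := row_ebase_unit P; have uC := col_ebase_unit P.
have PE := mulmx_ebase P.
split=> [yP i ki|tail].
  have -> : y = y *m P by apply/eqP; rewrite -subr_eq0 -{1}(mulmx1 y) -mulmxBr yP.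
  rewrite -{1}PE !mulmxA mulmxK// mul_pid_tail.
  by rewrite ltnNge ki.
have : y *m invmx (row_ebase P) = y *m invmx (row_ebase P) *m pid_mx (\rank P).
  apply/rowP => i; rewrite [RHS]mul_pid_tail; case: ltnP => // /tail ->.
  by [].
move=> /(congr1 (mulmxr (row_ebase P))); rewrite /= mulmxKV// => yE.
have : pid_mx (\rank P) *m row_ebase P = invmx (col_ebase P) *m P.
  by apply: (canRL (mulKmx uC)); rewrite mulmxA PE.
move=> E; move: yE; rewrite -(mulmxA (y *m _)) E !mulmxA => ->.
by rewrite mulmxBr mulmx1 -[X in _ - X]mulmxA PP subrr.
Qed.

Lemma derive_mulmx (V : normedModType R) n m (A : 'M[R]_(n, m)) (f : V -> 'rV[R]_n) x v :
  differentiable f x -> 'D_v (fun y => f y *m A) x = 'D_v f x *m A.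
Proof.
move=> df; have cA : continuous (mulmxr A : {linear 'rV[R]_n -> 'rV[R]_m}).
  exact: mulmxr_continuous.
have dA y : differentiable (mulmxr A : {linear 'rV[R]_n -> 'rV[R]_m}) y.
  exact: linear_differentiable.
rewrite [LHS](deriveE v (differentiable_comp df (dA _))).
by rewrite diff_comp//= diff_lin//= deriveE.
Qed.

Lemma derive_comp_jac n m k (f : 'rV[R]_n -> 'rV[R]_m) (g : 'rV[R]_m -> 'rV[R]_k) x v :
  differentiable f x -> differentiable g (f x) ->
  'D_v (g \o f) x = v *m jac f x *m jac g (f x).
Proof.
move=> df dg; rewrite (deriveE v (differentiable_comp df dg)) (diff_comp df dg).
by rewrite [LHS]/= -(deriveE v df) -(deriveE _ dg) (derive_jac _ dg) (derive_jac _ df).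
Qed.

(** With [P] the Jacobian, the differential is the sum of the squares of [P] and [1 - P]; both are
    idempotent and they add up to 1. *)
Lemma jac_straighten n (f : 'rV[R]_n -> 'rV[R]_n) (p : 'rV[R]_n) :
  differentiable f p -> jac f p *m jac f p = jac f p ->
  jac (fun q => f q *m jac f p + (q - f q) *m (1%:M - jac f p)) p = 1%:M.
Proof.
move=> df; set P := jac f p => PP.
have dM (g : 'rV[R]_n -> 'rV[R]_n) (A : 'M[R]_n) :
    differentiable g p -> differentiable (fun q => g q *m A) p.
  move=> dg; apply: (@differentiable_comp _ _ _ _ g (mulmxr A)) => //.
  by apply: linear_differentiable; exact: mulmxr_continuous.
have did : differentiable (id : 'rV[R]_n -> 'rV[R]_n) p by have [] := is_diff_id p.
have dB : differentiable (id - f) p := differentiableB did df.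
have E v : 'D_v (fun q => f q *m P + (q - f q) *m (1%:M - P)) p = v.
  have D1 : 'D_v (fun q => f q *m P) p = v *m P *m P.
    by rewrite (derive_mulmx _ _ df) (derive_jac _ df).
  have D3 : 'D_v (id - f) p = v - v *m P.
    have D := @is_deriveB R _ _ id f p v v _ (is_derive_id p v)
      (derivableP (@diff_derivable _ _ _ f p v df)).
    by rewrite /P -(derive_jac v df); exact: (@derive_val _ _ _ _ _ _ _ D).
  have D2 : 'D_v (fun q => (q - f q) *m (1%:M - P)) p = (v - v *m P) *m (1%:M - P).
    by rewrite (derive_mulmx (1%:M - P) v dB) D3.
  have D := @deriveD R _ _ _ _ p v (@diff_derivable _ _ _ _ p v (dM _ P df))
      (@diff_derivable _ _ _ _ p v (dM _ (1%:M - P) dB)).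
  rewrite [LHS]D D1 D2 -mulmxA PP mulmxBr mulmx1 mulmxBl -mulmxA PP subrr subr0.
  by rewrite addrC subrK.
by apply/matrixP => i j; rewrite mxE E !mxE eqxx eq_sym.
Qed.

(* With rho the retraction in coordinates and P its (idempotent) differential at
   p, the map y |-> rho y P + (y - rho y)(1 - P) has differential 1 at p, hence
   is a coordinate change; it maps the fixed points of rho to the image of P. *)
Lemma retract_slice_chart (M : smooth_space R) (S : set M) (x0 : S)
    (c : chart R M) (r : M -> M) :
  is_manifold M -> atlas c -> cdom c (set_val x0) -> (forall x, S (r x)) ->
  (\forall x \near (set_val x0 : M), S x -> r x = x) ->
  smooth_at (fun p => r (@cinv _ _ c p)) (cmap c (set_val x0)) ->
  exists2 d, @atlas R (@sub_space R M S) d & cdom d x0.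
Proof.
move=> mM ac cx rS rfix Sr.
have [oc rc dcr rcd [cc ci]] := manifold_chart mM ac.
set p0 := cmap c (set_val x0) in Sr *.
have [rp0 ep0] := dcr _ cx; rewrite -/p0 in rp0 ep0.
have Sx0 : S (set_val x0) := set_mem (valP x0).
have rx0 : r (set_val x0) = set_val x0 by exact: (nbhs_singleton rfix).
have cr0 : cdom c (r (@cinv _ _ c p0)) by rewrite ep0 rx0.
have [N0 [oN0 N0p0 N0c CN0]] := smooth_atE mM ac Sr cr0.
pose rho p := cmap c (r (@cinv _ _ c p)).
have crp : {for p0, continuous (fun p => r (@cinv _ _ c p))}.
  apply: smooth_at_continuous Sr => e; exact: manifold_chart.
(* The retraction must fix points of [S] both at [cinv p] and at its image; the latter gives
   [rho (rho p) = rho p]. *)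
have : nbhs p0 (N0 `&` @crng _ _ c `&`
    [set p | S (@cinv _ _ c p) -> r (@cinv _ _ c p) = @cinv _ _ c p] `&`
    [set p | S (r (@cinv _ _ c p)) -> r (r (@cinv _ _ c p)) = r (@cinv _ _ c p)]).
  apply: filterI; last first.
    have : (fun p => r (@cinv _ _ c p)) @ p0 --> r (@cinv _ _ c p0) := crp.
    by rewrite ep0 rx0 => /(_ _ rfix).
  apply: filterI; first by apply: open_nbhs_nbhs; split=> //; exact: openI.
  have : @cinv _ _ c @ p0 --> @cinv _ _ c p0 := ci _ rp0.
  by rewrite ep0 => /(_ _ rfix).
rewrite nbhsE => -[N1 [oN1 N1p0] N1P].
have N1c : N1 `<=` @crng _ _ c by move=> p /N1P[[[]]].
have Crho : Cinf N1 rho by move=> k; apply: Ck_sub (CN0 k) => p /N1P[[[]]].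
have rcinv p : N1 p -> @cinv _ _ c (rho p) = r (@cinv _ _ c p).
  by move=> /N1P[[[N0p _] _] _]; have [] := dcr _ (N0c _ N0p).
have rhorho p : N1 p -> rho (rho p) = rho p.
  by move=> N1p; rewrite {1}/rho rcinv//; have [_ ->] := N1P _ N1p; last exact: rS.
have rho0 : rho p0 = p0 by rewrite /rho ep0 rx0.
have drho p : N1 p -> differentiable rho p := Cinf_differentiable Crho.
pose P := jac rho p0.
have d0 : differentiable rho p0 by exact: drho.
(* Differentiate [rho \o rho = rho] at the fixed point [p0]. *)
have PP : P *m P = P.
  apply/row_matrixP => i; rewrite !rowE mulmxA; set v := delta_mx 0 i.
  have E1 : 'D_v (rho \o rho) p0 = v *m P *m P.
    have d0' : differentiable rho (rho p0) by rewrite rho0.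
    by have := derive_comp_jac v d0 d0'; rewrite rho0.
  rewrite -E1 -derive_jac//; apply: near_eq_derive.
  by apply: filterS (open_nbhs_nbhs (conj oN1 N1p0)) => p; exact: rhorho.
pose psi p := rho p *m P + (p - rho p) *m (1%:M - P).
have Cpsi : Cinf N1 psi.
  apply: CinfD => //; first exact: Cinf_mulmx.
  by apply: Cinf_mulmx => //; apply: CinfB => //; exact: Cinf_id.
have Jpsi : jac psi p0 = 1%:M. exact: jac_straighten.
have [N [W [theta [[oN Np0] NN1 oW [psiN thetaW] Ctheta]]]] :=
  inverse_function oN1 N1p0 Cpsi Jpsi.
pose E := row_ebase P; have uE : E \in unitmx by exact: row_ebase_unit.
(* Keeping [rho p] in [N] too allows the injectivity of [psi] on [N] to compare [p] with [rho p]. *)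
pose N' := [set p | N p /\ N (rho p)].
have oN' : open N'.
  by apply: open_preimage_in => // p /NN1; exact: (Cinf_continuous Crho).
pose W' := [set q | W (q *m E) /\ N' (theta (q *m E))].
have CE : Cinf setT (fun q : 'rV[R]_(cdim c) => q *m E).
  exact: Cinf_mulmx openT (@Cinf_id _ _ _).
have oWE : open [set q : 'rV[R]_(cdim c) | W (q *m E)].
  by apply: open_comp => // q _; exact: (Cinf_continuous CE).
have CthetaE : Cinf [set q | W (q *m E)] (fun q => theta (q *m E)).
  by move=> k; apply: (Ck_comp_row oWE oW _ _ (Ctheta k)) => //; apply: Ck_sub (CE k).
have oW' : open W'.
  by apply: open_preimage_in => // q Wq; exact: (Cinf_continuous CthetaE).
pose f p := psi p *m invmx E; pose g q := theta (q *m E).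
have fN' p : N' p -> W' (f p) /\ g (f p) = p.
  move=> N'p; have [Np _] := N'p; have [Wp tp] := psiN _ Np.
  by rewrite /f /g /W' /= mulmxKV// tp.
have gW' q : W' q -> N' (g q) /\ f (g q) = q.
  by move=> [Wq N'q]; split=> //; rewrite /f /g (thetaW _ Wq).2 mulmxK.
have Cf : Cinf N' f.
  apply: Cinf_mulmx => // k; apply: Ck_sub (Cpsi k) => p [Np _]; exact: NN1.
have Cg : Cinf W' g by move=> k; apply: Ck_sub (CthetaE k) => q [].
have N'c : N' `<=` @crng _ _ c by move=> p [/NN1/N1c].
pose C := recoordinate N' W' f g.
have hC : is_chart C by exact: recoordinate_is_chart.
have aC : atlas C by exact: recoordinate_atlas.
pose d := slice_chart C (\rank P) x0.
have sl : slice_of C d.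
  apply: slice_chartP => //; first exact: rank_leq_row.
  move=> x [cx' N'x]; apply: (iff_trans _ (idempotent_coord (psi (cmap c x)) PP)).
  set p := cmap c x in N'x *; have [Np Nrp] := N'x; have N1p := NN1 _ Np.
  have [rp ep] := dcr _ cx'; rewrite -/p in rp ep.
  have QQ : (1%:M - P) *m (1%:M - P) = 1%:M - P.
    by rewrite mulmxBr mulmx1 mulmxBl mul1mx PP subrr subr0.
  have PQ : P *m (1%:M - P) = 0 by rewrite mulmxBr mulmx1 PP subrr.
  have psiQ : psi p *m (1%:M - P) = (p - rho p) *m (1%:M - P).
    by rewrite /psi mulmxDl -!mulmxA PQ QQ mulmx0 add0r.
  rewrite psiQ; split=> [Sx|vanish].
    have [[_ fx] _] := N1P _ N1p; rewrite /= ep in fx.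
    by have rpp : rho p = p; [rewrite /rho ep fx|rewrite rpp subrr mul0mx].
  (* Both sides reduce to [rho p *m P]: the second summand of [psi] vanishes by hypothesis at [p],
     and by [rhorho] at [rho p]. *)
  have psip : psi p = psi (rho p).
    by rewrite {1}/psi vanish addr0 /psi (rhorho _ N1p) subrr mul0mx addr0.
  have pp : rho p = p.
    by have := (psiN _ Np).2; rewrite psip (psiN _ Nrp).2.
  by have := rS (@cinv _ _ c p); rewrite -rcinv// pp ep.
exists d; first by exists C.
by split=> //=; split=> //; rewrite rho0.
Qed.

End NeighbourhoodRetracts.

(** * Slice charts of the inertia groupoid *)

Section InertiaGeometry.
Local Set Implicit Arguments.
Local Unset Strict Implicit.
Local Open Scope classical_set_scope.
Local Open Scope ring_scope.
Variable R : realType.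

Lemma smooth_at_near_eq (V : normedModType R) (M : smooth_space R) (g g' : V -> M) x :
  (\forall y \near x, g y = g' y) -> smooth_at g x -> smooth_at g' x.
Proof.
move=> gg' [c [ac cx [N [oN Nx Nc CN]]]].
have : nbhs x (N `&` [set y | g y = g' y]).
  by apply: filterI => //; exact: open_nbhs_nbhs.
rewrite nbhsE => -[N' [oN' N'x] N'P].
exists c; split=> //; first by rewrite -(N'P _ N'x).2.
exists N'; split=> //; first by move=> y /N'P[Ny <-]; exact: Nc.
move=> k; apply: (@Ck_eq _ _ _ _ _ (fun y => cmap c (g y))) => //.
  by move=> y /N'P[_ ->].
by apply: Ck_sub (CN k) => y /N'P[].
Qed.

Lemma smooth_at_smooth (V : normedModType R) (M M' : smooth_space R) (f : M -> M')
    (g : V -> M) x :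
  is_manifold M -> smooth f -> smooth_at g x -> smooth_at (fun y => f (g y)) x.
Proof. by move=> mM sf; apply: (smooth_at_comp (manifold_charted mM) sf I). Qed.

Lemma smooth_at_manifold_continuous (V : normedModType R) (M : smooth_space R)
    (g : V -> M) (x : V) :
  is_manifold M -> smooth_at g x -> {for x, continuous g}.
Proof. by move=> mM; apply: smooth_at_continuous => c; exact: manifold_chart. Qed.

Lemma smooth_continuous (M M' : smooth_space R) (f : M -> M') :
  is_manifold M -> is_manifold M' -> smooth f -> continuous f.
Proof.
move=> mM mM' sf x; have [_ _ cov _ _] := mM; have [c ac cx] := cov x.
have [oc rc dcr rcd [cc ci]] := manifold_chart mM ac.
have [rx ex] := dcr _ cx.
have Sc := smooth_at_cinv (manifold_charted mM) ac rx.
have cf := smooth_at_manifold_continuous mM' (smooth_at_smooth mM sf Sc).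
apply: (cvg_trans _ (_ : ((fun p => f (@cinv _ _ c p)) \o cmap c) @ x --> f x)).
  apply: near_eq_cvg; apply: filterS (open_nbhs_nbhs (conj oc cx)) => y cy /=.
  by have [_ ->] := dcr _ cy.
rewrite -[X in _ --> f X]ex.
by apply: (@continuous_comp _ _ _ (cmap c)); [exact: cc|exact: cf].
Qed.

Variable G : groupoid R.
Hypothesis hE : etale G.

Let mO : is_manifold (obj G). Proof. by case: hE. Qed.
Let mA : is_manifold (arr G). Proof. by case: hE. Qed.
Let ldsrc : local_diffeo (@src R G). Proof. by case: hE => _ _ []. Qed.
Let ldtgt : local_diffeo (@tgt R G). Proof. by case: hE => _ _ []. Qed.
Let ssrc : smooth (@src R G). Proof. exact: local_diffeo_smooth. Qed.
Let stgt : smooth (@tgt R G). Proof. exact: local_diffeo_smooth. Qed.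
Let sinv : smooth (@inv R G).
Proof. by apply: local_diffeo_smooth; case: hE => _ _ _ []. Qed.

Lemma composable_charted : charted (composable G).
Proof. exact/sub_space_charted/prod_space_charted. Qed.

Definition mk_comp (a b : arr G) (ab : tgt a = src b) : composable G :=
  exist _ (a, b) (mem_set (ab : [set p : arr G * arr G | tgt p.1 = src p.2] (a, b))).

Lemma smooth_at_composable (V : normedModType R) (k : V -> composable G) x :
  smooth_at (fun y => comp_fst (k y)) x -> smooth_at (fun y => comp_snd (k y)) x ->
  smooth_at k x.
Proof. exact: (smooth_at_fibre_product mA mA mO stgt ldsrc). Qed.

Lemma smooth_at_mul (V : normedModType R) (a b : V -> arr G) x :
  (\forall y \near x, tgt (a y) = src (b y)) -> smooth_at a x -> smooth_at b x ->
  smooth_at (fun y => mul (a y) (b y)) x.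
Proof.
move=> ab Sa Sb; have abx := nbhs_singleton ab.
(* The pair is composable only near [x]; elsewhere [k] takes its value at [x], which the germ does
   not see. *)
pose k y := if pselect (tgt (a y) = src (b y)) is left e then mk_comp e else mk_comp abx.
have kE : \forall y \near x, comp_fst (k y) = a y /\ comp_snd (k y) = b y.
  by apply: filterS ab => y e; rewrite /k; case: pselect.
have Sk : smooth_at k x.
  apply: smooth_at_composable.
    by apply: smooth_at_near_eq Sa; apply: filterS kE => y [].
  by apply: smooth_at_near_eq Sb; apply: filterS kE => y [].
have sm : smooth (@comp_mul R G) by apply: local_diffeo_smooth; case: hE.
have := smooth_at_comp composable_charted sm I Sk.
by apply: smooth_at_near_eq; apply: filterS kE => y [/= k1 k2]; rewrite /comp_mul k1 k2.
Qed.

Lemma inv_inv (a : arr G) : inv (inv a) = a.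
Proof.
have e : tgt (inv a) = src a by rewrite tgt_inv.
rewrite -[RHS](mul_invK e) mul_invl.
by have := mul_idnr (inv (inv a)); rewrite tgt_inv src_inv => ->.
Qed.

Lemma conjugK (v a : arr G) : src v = tgt v -> src a = tgt v ->
  conjug (conjug v a) (inv a) = v.
Proof.
move=> hv ha; rewrite conjug_mul ?src_inv// mul_invr ha; exact: conjug_idn.
Qed.

Lemma inertia_arr_charted : charted (inertia_arr G).
Proof. exact/sub_space_charted/prod_space_charted. Qed.

Section Arrows.
Variables (V : normedModType R) (k : V -> inertia_arr G) (x : V).
Hypothesis Sk : smooth_at k x.

Lemma smooth_at_iarr_loop : smooth_at (fun y => iarr_loop (k y)) x.
Proof. exact: (smooth_at_pair mA mA (smooth_at_val Sk)).1. Qed.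

Lemma smooth_at_iarr_arrow : smooth_at (fun y => iarr_arrow (k y)) x.
Proof. exact: (smooth_at_pair mA mA (smooth_at_val Sk)).2. Qed.

Lemma smooth_at_conjug :
  smooth_at (fun y => conjug (iarr_loop (k y)) (iarr_arrow (k y))) x.
Proof.
have vP y := iarr_loopP (k y); have aP y := iarr_arrowP (k y).
apply: smooth_at_mul.
- by apply: nearW => y; rewrite tgt_inv src_mul// vP.
- exact: smooth_at_smooth mA sinv smooth_at_iarr_arrow.
- apply: smooth_at_mul; [exact: nearW|exact: smooth_at_iarr_loop|].
  exact: smooth_at_iarr_arrow.
Qed.

End Arrows.

(* A local section (e1, e2) of L makes the loops near L k0 a neighbourhood
   retract, with retraction L composed with the projection of the slice chart. *)
Lemma inertia_slice (k0 : inertia_arr G) (D : chart R (inertia_arr G))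
    (L : inertia_arr G -> inertia_obj G) (e1 e2 : arr G -> arr G) :
  @atlas R (inertia_arr G) D -> cdom D k0 ->
  (forall n (g : 'rV[R]_n -> inertia_arr G) p, smooth_at g p ->
    smooth_at (fun y => loop_of (L (g y))) p) ->
  e1 (loop_of (L k0)) = iarr_loop k0 -> e2 (loop_of (L k0)) = iarr_arrow k0 ->
  (forall n (g : 'rV[R]_n -> arr G) p, g p = loop_of (L k0) -> smooth_at g p ->
    smooth_at (fun y => e1 (g y)) p /\ smooth_at (fun y => e2 (g y)) p) ->
  (\forall x \near loop_of (L k0), src x = tgt x ->
    [/\ src (e1 x) = tgt (e1 x), src (e2 x) = tgt (e1 x) &
      forall k, iarr_loop k = e1 x -> iarr_arrow k = e2 x -> loop_of (L k) = x]) ->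
  exists2 d, @atlas R (inertia_obj G) d & cdom d (L k0).
Proof.
move=> aD Dk0 SL E1 E2 Se near_sec.
have [C aC [le Sc cd rc [md id]]] := aD.
have [oD dD rD] := inertia_arr_charted aD.
set v0 := loop_of (L k0) in E1 E2 Se near_sec *.
have [_ _ cov _ _] := mA; have [c ac cv0] := cov v0.
have [oc rgc dcr rcd [cc ci]] := manifold_chart mA ac.
have [rp0 ep0] := dcr _ cv0.
have k0E : (e1 v0, e2 v0) = set_val k0 by rewrite E1 E2 [RHS]surjective_pairing.
have Ck0 : cdom C (set_val k0) by exact/cd.
have Sc0 := smooth_at_cinv (manifold_charted mA) ac rp0.
have [S1 S2] := Se _ _ _ ep0 Sc0.
have C0 : cdom C (e1 (@cinv _ _ c (cmap c v0)), e2 (@cinv _ _ c (cmap c v0))).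
  by rewrite ep0 k0E.
have [N [oN Np0 NC CN]] := smooth_at_prodE mA mA aC C0 S1 S2.
(* Truncating coordinates with [pad] pushes the pair [(e1 x, e2 x)] onto the inertia arrows even
   when [x] is not a loop. Every value of [r] is a loop because [L] takes values in loops. *)
pose r x := loop_of (L (@cinv _ _ D (pad (cdim D) (cmap C (e1 x, e2 x))))).
apply: (@retract_slice_chart _ _ _ (L k0) c r) => //.
- by move=> x; exact: loop_ofP.
- have near_N : \forall x \near (v0 : arr G), cdom c x /\ N (cmap c x).
    apply: filterI; first exact: open_nbhs_nbhs.
    by apply: (cc _ cv0); exact: open_nbhs_nbhs.
  apply: filterS2 near_N near_sec => x [cx Nx] sec Sx.
  have [s1 s2 Lx] := sec Sx.
  have := NC _ Nx; rewrite (dcr _ cx).2 => Cx.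
  pose k := mk_iarr s1 s2.
  have Dk : cdom D k by exact/cd.
  have := (dD _ Dk).2; rewrite md// => kE.
  by rewrite /r kE; exact: Lx.
- apply: (SL _ (fun p => @cinv _ _ D (pad (cdim D) (cmap C (e1 (@cinv _ _ c p), e2 (@cinv _ _ c p)))))).
  apply: (smooth_at_reparam oN Np0 (Cinf_pad (cdim D) oN CN)).
  apply: smooth_at_cinv => //; first exact: inertia_arr_charted.
  by rewrite ep0 k0E -md//; exact: (dD _ Dk0).1.
Qed.

(** The section sends [v] to the pair of [v] and the arrow starting at [tgt v] chosen by a local
    inverse of [src]. *)
Lemma isrc_slice (k0 : inertia_arr G) (D : chart R (inertia_arr G)) :
  @atlas R (inertia_arr G) D -> cdom D k0 ->
  exists2 d, @atlas R (inertia_obj G) d & cdom d (isrc k0).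
Proof.
move=> aD Dk0; set a0 := iarr_arrow k0.
have [U [W [s [oU Ua oW [sU sW] [_ ss]]]]] := ldsrc a0.
have Wv : W (tgt (iarr_loop k0)) by rewrite -iarr_arrowP; exact: (sU _ Ua).1.
apply: (@inertia_slice k0 D _ id (fun v => s (tgt v))) => //.
- by move=> n g p Sg; exact: smooth_at_iarr_loop.
- by rewrite -[loop_of _]/(iarr_loop k0) -iarr_arrowP (sU _ Ua).2.
- move=> n g p gp Sg; split=> //.
  apply: (smooth_at_comp (manifold_charted mO) ss); first by rewrite gp.
  exact: smooth_at_smooth.
- have : \forall x \near loop_of (isrc k0), W (tgt x).
    by apply: (smooth_continuous mA mO stgt); exact: open_nbhs_nbhs.
  by apply: filterS => x Wx Sx; split=> //; rewrite (sW _ Wx).2.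
Qed.

(** A local inverse [s] of [tgt] chooses an arrow [b] ending at the base of [w]; then [b w b^-1] is
    a loop whose conjugate by [b] is [w]. The section must be smooth on all arrows near the loop, so
    the two factors use [s (src w)] and [s (tgt w)], which keeps the product composable when [w] is
    not a loop. *)
Lemma itgt_slice (k0 : inertia_arr G) (D : chart R (inertia_arr G)) :
  @atlas R (inertia_arr G) D -> cdom D k0 ->
  exists2 d, @atlas R (inertia_obj G) d & cdom d (itgt k0).
Proof.
move=> aD Dk0; set a0 := iarr_arrow k0.
have vP := iarr_loopP k0; have aP := iarr_arrowP k0.
have [U [W [s [oU Ua oW [sU sW] [_ ss]]]]] := ldtgt a0.
have [Wt sa] := sU _ Ua.
have srcw : src (loop_of (itgt k0)) = tgt a0 by exact: src_conjug.
have tgtw : tgt (loop_of (itgt k0)) = tgt a0 by exact: tgt_conjug.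
apply: (@inertia_slice k0 D _
  (fun w => mul (s (src w)) (mul w (inv (s (tgt w))))) (fun w => s (src w))) => //.
- by move=> n g p Sg; exact: smooth_at_conjug.
- rewrite srcw tgtw sa -[X in mul X]inv_inv; exact: conjugK.
- by rewrite srcw sa.
- move=> n g p gp Sg.
  have Ssg : smooth_at (fun y => s (src (g y))) p.
    apply: (smooth_at_comp (manifold_charted mO) ss); first by rewrite gp srcw.
    exact: smooth_at_smooth.
  have Stg : smooth_at (fun y => s (tgt (g y))) p.
    apply: (smooth_at_comp (manifold_charted mO) ss); first by rewrite gp tgtw.
    exact: smooth_at_smooth.
  have nearW' (F : arr G -> obj G) : smooth F -> W (F (g p)) ->
      \forall y \near p, W (F (g y)).
    move=> sF WF; apply: (smooth_at_manifold_continuous mO (smooth_at_smooth mA sF Sg)).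
    exact: open_nbhs_nbhs.
  have Ws : \forall y \near p, W (src (g y)) by apply: nearW' => //; rewrite gp srcw.
  have Wt' : \forall y \near p, W (tgt (g y)) by apply: nearW' => //; rewrite gp tgtw.
  have cmp : \forall y \near p, tgt (g y) = src (inv (s (tgt (g y)))).
    by apply: filterS Wt' => y Wy; rewrite src_inv (sW _ Wy).2.
  split=> //; apply: smooth_at_mul => //.
    by apply: filterS2 Ws cmp => y Wy cy; rewrite (sW _ Wy).2 src_mul.
  by apply: smooth_at_mul => //; exact: smooth_at_smooth.
- have : \forall x \near loop_of (itgt k0), W (src x).
    by apply: (smooth_continuous mA mO ssrc); apply: open_nbhs_nbhs; rewrite srcw.
  apply: filterS => x Wx Sx; rewrite -Sx; set b := s (src x).
  have tb : tgt b = src x by exact: (sW _ Wx).2.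
  have xb : tgt x = src (inv b) by rewrite src_inv -Sx.
  have bxb : tgt b = src (mul x (inv b)) by rewrite src_mul.
  split.
  + by rewrite src_mul// !tgt_mul// tgt_inv.
  + by rewrite !tgt_mul// tgt_inv.
  + move=> k kl ka; rewrite -[LHS]/(conjug (iarr_loop k) (iarr_arrow k)) kl ka.
    have -> : mul b (mul x (inv b)) = conjug x (inv b) by rewrite /conjug inv_inv.
    by rewrite -[X in conjug _ X]inv_inv conjugK// src_inv tb.
Qed.

Lemma smooth_at_isrc (V : normedModType R) (k : V -> inertia_arr G) x :
  smooth_at k x -> smooth_at (fun y => isrc (k y)) x.
Proof.
move=> Sk; have [D [aD Dx _]] := Sk; have [d ad dx] := isrc_slice aD Dx.
by apply: (smooth_at_sub mA ad dx); exact: smooth_at_iarr_loop.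
Qed.

Lemma smooth_at_itgt (V : normedModType R) (k : V -> inertia_arr G) x :
  smooth_at k x -> smooth_at (fun y => itgt (k y)) x.
Proof.
move=> Sk; have [D [aD Dx _]] := Sk; have [d ad dx] := itgt_slice aD Dx.
by apply: (smooth_at_sub mA ad dx); exact: smooth_at_conjug.
Qed.

End InertiaGeometry.

(** * Differential forms *)

Section Forms.
Local Set Implicit Arguments.
Local Unset Strict Implicit.
Local Open Scope classical_set_scope.
Local Open Scope ring_scope.
Local Open Scope complex_scope.
Variable R : realType.

Lemma velocity_near_eq (M : smooth_space R) (c : chart R M) (g g' : R -> M) :
  (\forall t \near (0 : R), g t = g' t) -> velocity c g = velocity c g'.
Proof.
by move=> gg'; apply: near_eq_derive; apply: filterS gg' => t ->.
Qed.

Lemma velocity_cst (M : smooth_space R) (c : chart R M) (x : M) :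
  velocity c (fun=> x) = 0.
Proof. exact: (@derive_cst R R^o). Qed.

Lemma smooth_cst_curve (M : smooth_space R) (x : M) :
  is_manifold M -> smooth_curve (fun=> x).
Proof. exact: smooth_cst. Qed.

(** A form is encoded as a function of whole curves; [is_form1] makes it depend only on base point
    and velocity, hence on the germ. *)
Lemma form1_near_eq (M : smooth_space R) (A : form1 M) (g g' : R -> M) :
  is_manifold M -> is_form1 A -> smooth_curve g ->
  (\forall t \near (0 : R), g t = g' t) -> A g = A g'.
Proof.
move=> [_ _ cov _ _] fA Sg gg'; have [c ac cx] := cov (g 0).
have [a [_ Aa]] := fA c ac.
have g0 : g 0 = g' 0 := nbhs_singleton gg'.
have Sg' : smooth_curve g' by exact: (@smooth_at_near_eq R R^o M g g' 0).
have cx' : cdom c (g' 0) by rewrite -g0.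
by rewrite (Aa _ Sg cx) (Aa _ Sg' cx') -g0 (velocity_near_eq c gg').
Qed.

Lemma form2_near_eq (M : smooth_space R) (B : form2 M) (g1 g1' g2 g2' : R -> M) :
  is_manifold M -> is_form2 B -> smooth_curve g1 -> smooth_curve g2 -> g1 0 = g2 0 ->
  (\forall t \near (0 : R), g1 t = g1' t) -> (\forall t \near (0 : R), g2 t = g2' t) ->
  B g1 g2 = B g1' g2'.
Proof.
move=> [_ _ cov _ _] fB S1 S2 g12 e1 e2; have [c ac cx] := cov (g1 0).
have [b [_ _ Bb]] := fB c ac.
have g10 : g1 0 = g1' 0 := nbhs_singleton e1.
have g20 : g2 0 = g2' 0 := nbhs_singleton e2.
have S1' : smooth_curve g1' by exact: (@smooth_at_near_eq R R^o M g1 g1' 0).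
have S2' : smooth_curve g2' by exact: (@smooth_at_near_eq R R^o M g2 g2' 0).
have g12' : g1' 0 = g2' 0 by rewrite -g10 -g20.
have cx' : cdom c (g1' 0) by rewrite -g10.
rewrite (Bb _ _ S1 S2 g12 cx) (Bb _ _ S1' S2' g12' cx') -g10.
by rewrite (velocity_near_eq c e1) (velocity_near_eq c e2).
Qed.

Lemma form1_cst (M : smooth_space R) (A : form1 M) (x : M) :
  is_manifold M -> is_form1 A -> A (fun=> x) = 0.
Proof.
move=> mM fA; have [_ _ cov _ _] := mM; have [c ac cx] := cov x.
have [a [_ Aa]] := fA c ac.
rewrite (Aa _ (smooth_cst_curve x mM) cx) big1// => i _.
by rewrite velocity_cst mxE mulr0.
Qed.

Lemma form2_cst (M : smooth_space R) (B : form2 M) (x : M) (g : R -> M) :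
  is_manifold M -> is_form2 B -> smooth_curve g -> g 0 = x -> B (fun=> x) g = 0.
Proof.
move=> mM fB Sg gx; have [_ _ cov _ _] := mM; have [c ac cx] := cov x.
have [b [_ _ Bb]] := fB c ac.
rewrite (Bb _ _ (smooth_cst_curve x mM) Sg (esym gx) cx) big1// => i _.
by rewrite big1// => j _; rewrite velocity_cst mxE mulr0 mul0r.
Qed.

Lemma cexp0 : cexp (0 : R[i]) = 1.
Proof. by rewrite /cexp /= expR0 cos0 sin0 mulr1 mulr0. Qed.

Lemma cint01_0 : cint01 (fun=> 0 : R[i]) = 0.
Proof. by rewrite /cint01 /Rintegral integral0. Qed.

Lemma coord_curve_smooth (M : smooth_space R) (c : chart R M) p i :
  charted M -> atlas c -> crng p -> smooth_curve (@coord_curve R M c p i).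
Proof.
move=> hM ac rp.
apply: (@smooth_at_reparam R R^o _ M (@cinv _ _ c)
  (fun t : R^o => p + t *: delta_mx 0 i) setT 0 openT I).
  apply: CinfD; [exact: openT|exact: Cinf_cst|].
  move=> k; apply: Ck_rowP => [|j]; first exact: openT.
  apply: (Ck_eq openT _ (CkM openT (@Cinf_id R R^o setT k)
    (@Ck_cst R R^o R^o k setT ((delta_mx 0 i : 'rV[R]_(cdim c)) 0 j)))) => t _.
  by rewrite !mxE.
by rewrite scale0r addr0; exact: smooth_at_cinv.
Qed.

Lemma coord_curve0 (M : smooth_space R) (c : chart R M) p i :
  @coord_curve R M c p i 0 = cinv p.
Proof. by rewrite /coord_curve scale0r addr0. Qed.

Lemma near_coord n (p v : 'rV[R]_n) (U : set 'rV[R]_n) :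
  open U -> U p -> \forall t \near (0 : R), U (p + t *: v).
Proof.
move=> oU Up.
have : p + t *: v @[t --> (0 : R)] --> p.
  rewrite -[X in _ --> X]addr0 -(scale0r v).
  by apply: cvgD; [exact: cvg_cst|exact: scalel_continuous].
by move=> /(_ U); apply; exact: open_nbhs_nbhs.
Qed.

Lemma pad_delta n m (le : (n <= m)%N) (i : 'I_n) :
  pad m (delta_mx 0 i : 'rV[R]_n) = delta_mx 0 (widen_ord le i).
Proof.
apply/rowP => j; rewrite !mxE; case: insubP => [k _ kj|].
  by rewrite mxE !eqxx -val_eqE kj.
rewrite -leqNgt eqxx /=; case: eqP => // -> /=.
by rewrite leqNgt ltn_ord.
Qed.

(** As [pad] is linear, the two difference quotients are the same function, so no differentiability
    of [F] enters. *)
Lemma cderive_pad n m (F : 'rV[R]_m -> R[i]) (p v : 'rV[R]_n) :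
  cderive v (fun q => F (pad m q)) p = cderive (pad m v) F (pad m p).
Proof.
rewrite /cderive; congr Complex; apply: (congr1 (fun f : R -> R^o => lim (f @ 0^')));
  by apply/funext => t /=; rewrite padD padZ.
Qed.

Section SubspaceForms.
Variables (M : smooth_space R) (S : set M) (A : form1 M).
Variable omega : form1 (@sub_space R M S).
Hypotheses (mM : is_manifold M) (fA : is_form1 A).
Hypothesis omegaE : forall g, smooth_curve g -> omega g = A (fun s => set_val (g s)).

(** The coefficients are the first [cdim d] ones of [A]: along a curve in [S] the other coordinates
    are constantly 0, and so are their velocities. *)
Lemma restrict_form1 : is_form1 omega.
Proof.
move=> d [c ac sl]; have [le Sc cd rc [md id]] := sl.
have [a [Ca Aa]] := fA ac.
have [oc rgc dr rd [cc ci]] := manifold_chart mM ac.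
have [od _ _] := sub_space_charted (manifold_charted mM) (ex_intro2 _ _ c ac sl).
exists (fun i q => a (widen_ord le i) (pad _ q)); split.
  move=> i; apply: (cCinf_comp od _ _ (Ca (widen_ord le i))).
    by move=> q /rc.
  exact: Cinf_pad od (@Cinf_id _ _ _).
move=> g Sg dg0.
pose gM s : M := set_val (g s).
have SgM : smooth_curve gM by exact: (@smooth_at_val R R^o M S g 0 Sg).
have cg0 : cdom c (gM 0) by exact/cd.
rewrite omegaE// (Aa _ SgM cg0) (slice_cmap sl dg0).
have [N [oN N0 Nc CN]] := @smooth_atE R R^o M gM 0 c mM ac SgM cg0.
have nN : \forall t \near (0 : R^o), N t by exact: open_nbhs_nbhs.
have dc : derivable (fun s : R^o => cmap c (gM s)) 0 1.
  exact: diff_derivable (Cinf_differentiable CN N0).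
have Cd := Cinf_pad (cdim d) oN CN.
have cdE : \forall t \near (0 : R^o), cmap d (g t) = pad (cdim d) (cmap c (gM t)).
  by apply: filterS nN => t Nt; rewrite md//; apply/cd; exact: Nc.
have vc i : velocity c gM 0 i = 'D_(1 : R^o) (fun s : R^o => cmap c (gM s) 0 i : R^o) 0.
  by rewrite /velocity (derive_mx dc) mxE.
have vd j : velocity d g 0 j = velocity c gM 0 (widen_ord le j).
  have -> : velocity d g = 'D_(1 : R^o) (fun s : R^o => pad (cdim d) (cmap c (gM s))) 0.
    exact: near_eq_derive.
  rewrite (derive_mx (diff_derivable (Cinf_differentiable Cd N0))) mxE vc.
  have -> : (fun s : R^o => pad (cdim d) (cmap c (gM s)) 0 j) =
      (fun s : R^o => cmap c (gM s) 0 (widen_ord le j)).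
    apply/funext => s; rewrite mxE insubT; first exact: leq_trans le.
    by move=> lt; congr (cmap c _ 0 _); exact: val_inj.
  by [].
rewrite (bigID (fun i : 'I_(cdim c) => (i < cdim d)%N))/= [X in _ + X]big1 => [|i].
  rewrite addr0 (big_ord_narrow le); apply: eq_bigr => i _.
  by rewrite vd.
rewrite -leqNgt => di; rewrite vc.
have -> : 'D_(1 : R^o) (fun s : R^o => cmap c (gM s) 0 i : R^o) 0 = 'D_(1 : R^o) (fun=> 0 : R^o) 0.
  apply: near_eq_derive; apply: filterS nN => t Nt.
  by apply: ((Sc _ (Nc _ Nt)).1 (set_mem (valP (g t)))).
by rewrite derive_cst mulr0.
Qed.

(** Near time 0 the coordinate curves of a slice chart are coordinate curves of the ambient chart
    that stay in [S]. Only on those must [B] vanish. *)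
Lemma restrict_d (B : form2 M) : is_d A B ->
  (forall c p i j, atlas c -> crng p -> S (@cinv _ _ c p) ->
     (\forall t \near (0 : R), S (@coord_curve R M c p i t)) ->
     (\forall t \near (0 : R), S (@coord_curve R M c p j t)) ->
     B (@coord_curve R M c p i) (@coord_curve R M c p j) = 0) ->
  is_d omega (fun _ _ => 0).
Proof.
move=> dA B0 d ad p rp i j; have [c ac sl] := ad.
have [le Sc cd rc [md id]] := sl.
have hS := sub_space_charted (manifold_charted mM) (S := S).
have [od dd rd] := hS _ ad.
have [oc rgc dr rrd [cc ci]] := manifold_chart mM ac.
pose w := widen_ord le.
have coordE q l : @crng _ _ d q -> \forall t \near (0 : R),
    set_val (@coord_curve R _ d q l t) = @coord_curve R M c (pad _ q) (w l) t.
  move=> rq; have := near_coord (delta_mx 0 l) od rq.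
  by apply: filterS => t rt; rewrite /coord_curve id// padD padZ (pad_delta le).
have omegaC l : \forall q \near p,
    omega (@coord_curve R _ d q l) = A (@coord_curve R M c (pad _ q) (w l)).
  have : \forall q \near p, @crng _ _ d q by exact: open_nbhs_nbhs.
  apply: filterS => q rq; have Sq := coord_curve_smooth l hS ad rq.
  rewrite omegaE//; apply: form1_near_eq => //; last exact: coordE.
  exact: (@smooth_at_val R R^o M S _ 0 Sq).
have cdE k l : cderive (delta_mx 0 k) (fun q => omega (@coord_curve R _ d q l)) p =
    cderive (delta_mx 0 (w k)) (fun q => A (@coord_curve R M c q (w l))) (pad _ p).
  rewrite (near_eq_cderive _ (omegaC l)) -(pad_delta le).
  exact: (cderive_pad (fun q => A (@coord_curve R M c q (w l)))).
rewrite !cdE; have rcp : @crng _ _ c (pad _ p) by exact/rc.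
rewrite -(dA c ac _ rcp (w i) (w j)) B0//.
- by rewrite -id//; exact: (set_mem (valP (@cinv _ _ d p))).
- by apply: filterS (coordE _ i rp) => t <-; exact: (set_mem (valP (coord_curve p i t))).
- by apply: filterS (coordE _ j rp) => t <-; exact: (set_mem (valP (coord_curve p j t))).
Qed.

End SubspaceForms.

End Forms.

(** * Holonomy along constant loops *)

Section Holonomy.
Local Set Implicit Arguments.
Local Unset Strict Implicit.
Local Open Scope classical_set_scope.
Local Open Scope ring_scope.
Local Open Scope complex_scope.
Variables (R : realType) (G : groupoid R).
Hypothesis hG : orbifold_groupoid G.
Variables (h : arr G -> arr G -> R[i]) (A : form1 (arr G)) (B : form2 (obj G)).
Hypothesis hgerbe : is_gerbe h A B.

Let hE : etale G. Proof. by case: hG. Qed.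
Let mO : is_manifold (obj G). Proof. by case: hE. Qed.
Let mA : is_manifold (arr G). Proof. by case: hE. Qed.
Let ssrc : smooth (@src R G).
Proof. by apply: local_diffeo_smooth; case: hE => _ _ []. Qed.
Let stgt : smooth (@tgt R G).
Proof. by apply: local_diffeo_smooth; case: hE => _ _ []. Qed.
Let sidn : smooth (@idn R G).
Proof. by apply: local_diffeo_smooth; case: hE => _ _ _ []. Qed.
Let fA : is_form1 A. Proof. by case: hgerbe => _ []. Qed.
Let fB : is_form2 B. Proof. by case: hgerbe => _ []. Qed.
Let dA : is_d A (fun g g' => pull2 (@tgt R G) B g g' - pull2 (@src R G) B g g').
Proof. by case: hgerbe. Qed.
Let h_neq0 a b : tgt a = src b -> h a b != 0.
Proof. by case: hgerbe => -[+ _] _ _ _ _; exact. Qed.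

(** The fraction-free form lets several instances be multiplied together and cancelled. *)
Lemma gerbe_cocycle a b c : tgt a = src b -> tgt b = src c ->
  h a b * h (mul a b) c = h b c * h a (mul b c).
Proof.
move=> ab bc; have [_ _ /(_ a b c ab bc) coc _ _] := hgerbe.
have n1 : h a (mul b c) != 0 by apply: h_neq0; rewrite src_mul.
have n2 : h b c != 0 by exact: h_neq0.
by rewrite -[RHS]mul1r -coc; field; rewrite n1 n2.
Qed.

Lemma gerbe_idnl a : h (idn (src a)) a = h (idn (src a)) (idn (src a)).
Proof.
set e := idn (src a).
have te : tgt e = src a by rewrite tgt_idn.
have ee : tgt e = src e by rewrite te src_idn.
have ea : mul e a = a by exact: mul_idnl.
have ide : mul e e = e by have := mul_idnl e; rewrite src_idn.
(* The cocycle at [(e, e, a)], with the common factor [h e a] cancelled. *)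
have := gerbe_cocycle ee te; rewrite ea ide mulrC => /mulfI; rewrite h_neq0//.
by move=> /(_ isT) ->.
Qed.

Lemma gerbe_idnr a : h a (idn (tgt a)) = h (idn (tgt a)) (idn (tgt a)).
Proof.
set e := idn (tgt a).
have se : tgt a = src e by rewrite src_idn.
have ee : tgt e = src e by rewrite tgt_idn -se.
have ae : mul a e = a by exact: mul_idnr.
have ide : mul e e = e by have := mul_idnl e; rewrite src_idn.
by have := gerbe_cocycle se ee; rewrite ae ide => /mulIf; rewrite h_neq0// => /(_ isT).
Qed.

Lemma gerbe_smooth (V : normedModType R) (k : V -> composable G) (x : V) :
  smooth_at k x ->
  exists N : set V, [/\ open N, N x &
    cCinf N (fun y => h (comp_fst (k y)) (comp_snd (k y)))].
Proof.
case: hgerbe => -[_ sh] _ _ _ _ Sk.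
exact: (csmooth_at (@composable_charted R G) sh Sk).
Qed.

Lemma const_holonomyE (k : arr (inertia G)) :
  const_holonomy h A hG k =
  h (iarr_loop k) (iarr_arrow k) /
  h (iarr_arrow k) (conjug (iarr_loop k) (iarr_arrow k)).
Proof.
rewrite /const_holonomy /holonomy /=.
(* Tangent curves of a constant path are constant, so [A] vanishes on them. *)
have -> : (fun t => A (tangent_curve (fun=> iarr_arrow k) t)) = (fun=> 0).
  by apply/funext => t; exact: form1_cst.
by rewrite cint01_0 cexp0 mul1r.
Qed.

(** * The two composable pairs defining the holonomy of a constant arrow *)

Lemma tgt_loop_arrow (k : inertia_arr G) : tgt (iarr_loop k) = src (iarr_arrow k).
Proof. by rewrite iarr_arrowP. Qed.

Lemma tgt_arrow_conjug (k : inertia_arr G) :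
  tgt (iarr_arrow k) = src (conjug (iarr_loop k) (iarr_arrow k)).
Proof. by rewrite src_conjug//; [exact: iarr_loopP|exact: iarr_arrowP]. Qed.

Definition loop_arrow_pair (k : inertia_arr G) : composable G :=
  mk_comp (tgt_loop_arrow k).

Definition arrow_conjug_pair (k : inertia_arr G) : composable G :=
  mk_comp (tgt_arrow_conjug k).

Lemma mul_arrow_conjug (k : inertia_arr G) :
  mul (iarr_arrow k) (conjug (iarr_loop k) (iarr_arrow k)) =
  mul (iarr_loop k) (iarr_arrow k).
Proof. exact: (const_arrow_end k). Qed.

Lemma smooth_at_loop_arrow_pair (V : normedModType R) (k : V -> inertia_arr G) x :
  smooth_at k x -> smooth_at (fun y => loop_arrow_pair (k y)) x.
Proof.
move=> Sk; apply: smooth_at_composable => //.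
  exact: smooth_at_iarr_loop.
exact: smooth_at_iarr_arrow.
Qed.

Lemma smooth_at_arrow_conjug_pair (V : normedModType R) (k : V -> inertia_arr G) x :
  smooth_at k x -> smooth_at (fun y => arrow_conjug_pair (k y)) x.
Proof.
move=> Sk; apply: smooth_at_composable => //.
  exact: smooth_at_iarr_arrow.
exact: smooth_at_conjug.
Qed.

Local Notation f := (const_holonomy h A hG).

Lemma const_holonomy_neq0 k : f k != 0.
Proof.
rewrite const_holonomyE mulf_neq0// ?invr_neq0// h_neq0//.
  exact: tgt_loop_arrow.
exact: tgt_arrow_conjug.
Qed.

Lemma const_holonomy_smooth_at (V : normedModType R) (k : V -> inertia_arr G) x :
  smooth_at k x -> exists N : set V, [/\ open N, N x & cCinf N (fun y => f (k y))].
Proof.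
move=> Sk.
have [N1 [oN1 N1x C1]] := gerbe_smooth (smooth_at_loop_arrow_pair Sk).
have [N2 [oN2 N2x C2]] := gerbe_smooth (smooth_at_arrow_conjug_pair Sk).
have oN : open (N1 `&` N2) by exact: openI.
exists (N1 `&` N2); split=> //.
have C1' : cCinf (N1 `&` N2) _ := cCinf_sub (@subIsetl _ N1 N2) C1.
have C2' : cCinf (N1 `&` N2) _ := cCinf_sub (@subIsetr _ N1 N2) C2.
apply: (cCinf_eq oN _ (cCinfM oN C1' (cCinfV oN _ C2'))).
  by move=> y _; rewrite const_holonomyE.
by move=> y _; apply: h_neq0; exact: tgt_arrow_conjug.
Qed.

Lemma const_holonomy_mul k l : tgt k = src l -> f (mul k l) = f k * f l.
Proof.
move=> kl; rewrite [mul k l](imulE kl) !const_holonomyE.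
set v := iarr_loop k; set a := iarr_arrow k; set b := iarr_arrow l.
have lE : iarr_loop l = conjug v a by rewrite [RHS](congr1 (@loop_of R G) kl).
rewrite -[iarr_loop (mk_iarr _ _)]/v -[iarr_arrow (mk_iarr _ _)]/(mul a b) lE.
have vP : src v = tgt v := iarr_loopP k.
have aP : src a = tgt v := iarr_arrowP k.
have ab : tgt a = src b := itgt_isrc kl.
have tw := tgt_conjug vP aP.
have sw := src_conjug vP aP.
set w := conjug v a in tw sw *.
have wP : src w = tgt w by rewrite sw tw.
have bP : src b = tgt w by rewrite tw ab.
have uE : conjug w b = conjug v (mul a b) by rewrite conjug_mul.
rewrite -uE; have su := src_conjug wP bP; set u := conjug w b in su *.
have aw : mul a w = mul v a := mul_arrow_conjug k.
have bu : mul b u = mul w b by rewrite /u /w -lE; exact: (mul_arrow_conjug l).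
(* The cocycles at [(v, a, b)], [(a, w, b)] and [(a, b, u)]. In the first and third combined against
   the second, [h (va) b], [h a b] and [h a (wb)] cancel, and multiplicativity remains. *)
have c1 := gerbe_cocycle (esym aP) ab.
have c2 : h a w * h (mul v a) b = h w b * h a (mul w b).
  by rewrite -aw; apply: gerbe_cocycle => //; rewrite bP.
have c3 : h a b * h (mul a b) u = h b u * h a (mul w b).
  by rewrite -bu; exact: gerbe_cocycle.
have n1 : h a w != 0 by exact: h_neq0.
have n2 : h b u != 0 by exact: h_neq0.
have n3 : h (mul a b) u != 0 by apply: h_neq0; rewrite tgt_mul.
have n4 : h (mul v a) b != 0 by apply: h_neq0; rewrite tgt_mul.
have n5 : h a b != 0 by exact: h_neq0.
have n6 : h a (mul w b) != 0 by apply: h_neq0; rewrite src_mul// bP.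
apply: (mulIf n3); apply: (mulIf n1); apply: (mulIf n2).
transitivity (h v (mul a b) * h a w * h b u); first by field.
transitivity (h v a * h w b * h (mul a b) u); last by field; rewrite n1 n2.
apply: (mulIf n4); apply: (mulIf n5); apply: (mulIf n6).
transitivity ((h a b * h v (mul a b)) * (h a w * h (mul v a) b) * (h b u * h a (mul w b))).
  by ring.
by rewrite -c1 c2 -c3; ring.
Qed.

Lemma const_holonomy_inv k : f (inv k) = (f k)^-1.
Proof.
(* The value at a unit is a nonzero idempotent. *)
have e1 : f (idn (src k)) = 1.
  have ee : tgt (idn (src k)) = src (idn (src k)) by rewrite tgt_idn src_idn.
  have := const_holonomy_mul ee.
  have -> : mul (idn (src k)) (idn (src k)) = idn (src k).
    by have := mul_idnl (idn (src k)); rewrite src_idn.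
  move=> /esym; rewrite -[X in _ = X -> _]mulr1 => /mulfI -> //.
  exact: const_holonomy_neq0.
have ki : tgt k = src (inv k) by rewrite src_inv.
have := const_holonomy_mul ki; rewrite mul_invr e1 => E.
by apply: (mulfI (const_holonomy_neq0 k)); rewrite -E mulfV// const_holonomy_neq0.
Qed.

Lemma const_holonomy_dlog (g : R -> inertia_arr G) : smooth_curve g ->
  A (fun t => loop_of (itgt (g t))) - A (fun t => loop_of (isrc (g t))) = - dlog f g.
Proof.
move=> Sg; have Sg' : @smooth_at R R^o (inertia_arr G) g 0 := Sg.
have [_ _ _ dh _] := hgerbe.
have S1 := smooth_at_loop_arrow_pair Sg'; have S2 := smooth_at_arrow_conjug_pair Sg'.
pose aV := A (fun t => iarr_loop (g t)); pose aA := A (fun t => iarr_arrow (g t)).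
pose aW := A (fun t => conjug (iarr_loop (g t)) (iarr_arrow (g t))).
pose aM := A (fun t => mul (iarr_loop (g t)) (iarr_arrow (g t))).
pose H (p : composable G) := h (comp_fst p) (comp_snd p).
have E1 : aV + aA - aM = dlog H (fun t => loop_arrow_pair (g t)) := dh _ S1.
have E2 : aA + aW - aM = dlog H (fun t => arrow_conjug_pair (g t)).
  have -> : aM = A (fun t => mul (iarr_arrow (g t))
      (conjug (iarr_loop (g t)) (iarr_arrow (g t)))).
    by congr A; apply/funext => t; rewrite mul_arrow_conjug.
  exact: (dh _ S2).
have [N1 [oN1 N1x C1]] := const_holonomy_smooth_at Sg'.
have [N2 [oN2 N2x C2]] := gerbe_smooth S2.
have N0 : (N1 `&` N2) (0 : R^o) by [].
have C1' : cCinf (N1 `&` N2) _ := cCinf_sub (@subIsetl _ N1 N2) C1.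
have C2' : cCinf (N1 `&` N2) _ := cCinf_sub (@subIsetr _ N1 N2) C2.
have := cderiveM (1 : R^o) N0 C1' C2'.
have n2 k : h (iarr_arrow k) (conjug (iarr_loop k) (iarr_arrow k)) != 0.
  by apply: h_neq0; exact: tgt_arrow_conjug.
(* Written as a product, the quotient defining [f] yields its logarithmic derivative by the Leibniz
   rule alone. *)
have fh k : f k * h (comp_fst (arrow_conjug_pair k)) (comp_snd (arrow_conjug_pair k)) =
    h (comp_fst (loop_arrow_pair k)) (comp_snd (loop_arrow_pair k)).
  by rewrite const_holonomyE divfK.
have -> : (fun t : R^o => f (g t) * h (comp_fst (arrow_conjug_pair (g t)))
    (comp_snd (arrow_conjug_pair (g t)))) =
  (fun t : R^o => h (comp_fst (loop_arrow_pair (g t))) (comp_snd (loop_arrow_pair (g t)))).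
  by apply/funext => t; exact: fh.
move=> D.
rewrite -[LHS]/(aW - aV).
have -> : aW - aV = (aA + aW - aM) - (aV + aA - aM) by ring.
rewrite E1 E2 /dlog /H D -(fh (g 0)); field.
rewrite const_holonomy_neq0; exact: n2.
Qed.

(** The hypothesis speaks only of loop vectors that represent the image of [g], so one has to be
    exhibited: the field along the loop that is the same at every time. *)
Lemma const_connectionE (omega : form1 (obj (inertia G))) :
  is_const_connection A B hG omega ->
  forall g, smooth_curve g -> omega g = A (fun s => loop_of (g s)).
Proof.
move=> omegaE g Sg.
have Sl : @smooth_at R R^o (arr G) (fun s => loop_of (g s)) 0.
  exact: (@smooth_at_val R R^o (arr G) _ g 0 Sg).
have Ss : smooth_curve (fun s => src (loop_of (g s))) := smooth_at_smooth mA ssrc Sl.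
have fld : smooth_field (fun _ : R => fun s => src (loop_of (g s))).
  move=> t _; split=> //; have [_ _ cov _ _] := mO.
  have [c ac cx] := cov (src (loop_of (g 0))).
  exists c; split=> //; exists setT; split=> //; first exact: openT.
  exact: Cinf_cst.
have stE : same_velocity (@tgt R G \o (fun s => loop_of (g s)))
    (fun s => src (loop_of (g s))).
  have -> : @tgt R G \o (fun s => loop_of (g s)) = (fun s => src (loop_of (g s))).
    by apply/funext => s /=; rewrite loop_ofP.
  by split.
pose xi := @LoopVector R G (const_loop hG (g 0)) (fun _ s => src (loop_of (g s)))
  (fun s => loop_of (g s)) fld (fun _ _ => erefl) Sl erefl (conj erefl (fun _ _ _ => erefl)) stE.
have xiP : is_const_vector xi by split=> [t _|]; split.
rewrite (omegaE g Sg xi xiP) /holonomy_connection /=.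
have -> : (fun t => B (tangent_curve (fun=> src (loop_of (g 0))) t)
    (fun s => src (loop_of (g s)))) = (fun=> 0).
  by apply/funext => t; exact: form2_cst.
by rewrite cint01_0 add0r.
Qed.

Lemma const_holonomy_unit : exists u : obj G -> R[i],
  [/\ (forall x, u x != 0), csmooth u &
     forall a : arr G, f (unit_iarr a) = u (tgt a) * (u (src a))^-1].
Proof.
have ee x : tgt (idn x) = src (idn x :> arr G) by rewrite tgt_idn src_idn.
have u0 x : h (idn x) (idn x) != 0 by exact: h_neq0.
exists (fun x => (h (idn x) (idn x))^-1); split.
- by move=> x; rewrite invr_neq0.
- apply: csmooth_of_smooth_at => [|n g p Sg]; first exact: manifold_charted.
  have Sk : smooth_at (fun y => mk_comp (ee (g y))) p.
    have Si := smooth_at_smooth mO sidn Sg.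
    by apply: (smooth_at_composable hE); exact: Si.
  have [N [oN Np CN]] := gerbe_smooth Sk.
  exists N; split=> //; apply: (cCinfV oN _ CN) => y _; exact: u0.
- move=> a; rewrite const_holonomyE invrK mulrC.
  rewrite -[iarr_loop _]/(idn (src a)) -[iarr_arrow _]/a.
  have -> : conjug (idn (src a)) a = idn (tgt a) by rewrite /conjug mul_idnl mul_invl.
  by rewrite gerbe_idnl gerbe_idnr mulrC.
Qed.

Lemma const_holonomy_inner (omega : form1 (obj (inertia G))) :
  is_const_connection A B hG omega -> inner_local_system f omega.
Proof.
move=> homega; have omegaE := const_connectionE homega.
split.
- split.
  + exact: const_holonomy_neq0.
  + apply: csmooth_of_smooth_at => [|n g p Sg]; first exact: inertia_arr_charted.
    exact: const_holonomy_smooth_at.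
  + exact: const_holonomy_mul.
  + exact: (restrict_form1 mA fA omegaE).
  (* Replacing [omega] by [A] at both ends requires the end curves to be smooth curves of loops. *)
  + move=> g Sg; rewrite /pull1 -const_holonomy_dlog//.
    rewrite !omegaE//.
      exact: (smooth_at_isrc hE (V := R^o) (k := g)).
    exact: (smooth_at_itgt hE (V := R^o) (k := g)).
(* On curves that stay among the loops near time 0, source and target have the same germ, so the two
   pullbacks of [B] cancel. *)
- apply: (restrict_d mA fA omegaE dA) => c p i j ac rp Sp Si Sj.
  have cs i' := coord_curve_smooth i' (manifold_charted mA) ac rp.
  rewrite /pull2 [X in X - _](_ : _ = B (@src R G \o coord_curve p i) (@src R G \o coord_curve p j)) ?subrr//.
  apply: form2_near_eq => //.
  + exact: (smooth_at_smooth mA stgt (cs i)).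
  + exact: (smooth_at_smooth mA stgt (cs j)).
  + by rewrite /= !coord_curve0.
  + by apply: filterS Si => t /= ->.
  + by apply: filterS Sj => t /= ->.
- exact: const_holonomy_unit.
- exact: const_holonomy_inv.
Qed.

End Holonomy.

Theorem theorem1p0p4 (R : realType) (G : groupoid R)
    (hG : orbifold_groupoid G) (hL : Leray G)
    (h : arr G -> arr G -> R[i]%C) (A : form1 (arr G)) (B : form2 (obj G))
    (hgerbe : is_gerbe h A B)
    (omega : form1 (obj (inertia G)))
    (homega : is_const_connection A B hG omega) :
  inner_local_system (const_holonomy h A hG) omega.
Proof. exact: (const_holonomy_inner hgerbe homega). Qed.
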